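(* Let $D\subset V=\mathbb{C}^n$ be a linear free divisor with reduced equation $h$ and $f\in\mathbb{C}[V]_1$ an $\mathcal{R}_h$-finite linear function. Suppose that the following hypothesis (H) holds for $(f,h)$, and that the minimal spectral number $\alpha_{\min}$ of $(G_t,\nabla)$ for $t\ne0$ has multiplicity one. (H): The pairing $S$ on the Gauss–Manin systems $\mathbf{G}_t$, $t\neq0$, is induced by a pairing $S:\mathbf{G}[t^{-1}]\otimes\overline{\mathbf{G}}[t^{-1}]\to\mathbb{C}[\tau,\tau^{-1},t,t^{-1}]$. Moreover, for the grading of $\mathbf{G}$ and $\mathbf{G}[t^{-1}]$ induced from that of $\Omega^{n-1}(\log h)$ by putting $\deg(\tau)=-1$, $\deg(t)=n$: (1) $S$ is homogeneous, i.e. it sends $(\mathbf{G}[t^{-1}])_k\otimes(\overline{\mathbf{G}[t^{-1}]})_l$ into $\mathbb{C}[\tau,\tau^{-1},t,t^{-1}]_{k+l}$; (2) $S$ sends $G\otimes\overline G$ into $\tau^{-n+1}\mathbb{C}[\tau^{-1},t]$. Then the (germ at the origin of the) $\mathcal{R}_h$-deformation space $M_0$ of $f$ carries a Frobenius structure which is constant, i.e. given by a potential of degree at most three (equivalently, such that the structure constants $c_{ij}^k$ defined by $\partial_{t_i}\circ\partial_{t_j}=\sum_kc_{ij}^k\partial_{t_k}$ are constant in flat coordinates $t_1,\dots,t_n$).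
   Context: A reduced hypersurface $D=\{h=0\}\subset V=\mathbb{C}^n$ is a linear free divisor if $\mathrm{Der}(-\log D)=\{\chi:\chi\cdot h\in(h)\}$ is a free module with a basis of weight-zero vector fields (all coefficients linear forms); then $h$ is homogeneous of degree $n$. $\mathrm{Der}(-\log h)=\{\chi\in\mathrm{Der}(-\log D):\chi\cdot h=0\}$. Put $T^1_{\mathcal{R}_h}f=\mathcal{O}_{\mathbb{C}^n,0}/(df(\mathrm{Der}(-\log h))+(h))$; $f$ is $\mathcal{R}_h$-finite if this is finite dimensional over $\mathbb{C}$ (it then has dimension $n$). $D_t=h^{-1}(t)$. The $\mathcal{R}_h$-deformation space $M_0$ is the base, with coordinates $u_1,\dots,u_n$, of the $\mathcal{R}_h$-semi-universal unfolding $F=f+\sum_{i=1}^nu_ig_i:V\times M_0\to\mathbb{C}$, where $g_1,\dots,g_n$ is a basis of $T^1_{\mathcal{R}_h}f$; it is a smooth germ with tangent space $T^1_{\mathcal{R}_h}f\cong G_0/\tau^{-1}G_0$. Forms are global algebraic; $\Omega^\bullet(\log h)=\Omega^\bullet(\log D)/(\tfrac{dh}{h}\wedge\Omega^{\bullet-1}(\log D))$, graded by weight ($x_i,dx_i$ of weight $1$). $\mathbf{G}=\Omega^{n-1}(\log h)[\tau^{\pm1}]/(d-\tau df\wedge)\Omega^{n-2}(\log h)[\tau^{\pm1}]$, $G=$ image of $\Omega^{n-1}(\log h)[\tau^{-1}]$ in $\mathbf{G}$; $t$ acts as $h$; $\partial_\tau=\nabla_{\partial_\tau}$ is given by $\tau^i\omega\mapsto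 i\tau^{i-1}\omega-\tau^if\omega$. These are free over $\mathbb{C}[t,\tau^{\pm1}]$ resp. $\mathbb{C}[t,\tau^{-1}]$ of rank $n$. $\mathbf{G}_t,G_t$ are the restrictions to fixed $t$, $\mathbf{G}[t^{-1}]$ the localisation, and a bar means that $\tau$ acts as $-\tau$. For $t\neq0$, $V_\bullet\mathbf{G}_t$ is the increasing Kashiwara–Malgrange filtration at $\tau=0$ indexed by $\mathbb{Q}$ ($\tau V_\beta=V_{\beta-1}$, $\tau\partial_\tau+\beta$ nilpotent on $gr^V_\beta$). The spectrum of $(G_t,\nabla)$ consists of the numbers $\beta$ with multiplicity $\dim\frac{V_\beta\cap G_t}{V_{<\beta}\cap G_t+\tau^{-1}G_t\cap V_\beta}$. Since $f_{|D_t}$ is cohomologically tame, by Sabbah $\mathbf{G}_t$ carries a non-degenerate flat Hermitian pairing $S:\mathbf{G}_t\otimes\overline{\mathbf{G}}_t\to\mathbb{C}[\tau^{\pm1}]$ with $S(V_0,\overline V_{<1})\subset\mathbb{C}[\tau]$ and $S(G_t,\overline G_t)\subset\tau^{-n+1}\mathbb{C}[\tau^{-1}]$, inducing a non-degenerate symmetric pairing on $G_t/\tau^{-1}G_t$; this is the pairing $S$ in (H). *)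

(* Defs.v *)
From HB Require Import structures.
From mathcomp Require Import all_boot all_order all_algebra.
From mathcomp Require Import complex mpoly.
From mathcomp Require Import boolp classical_sets functions cardinality fsbigop.
From mathcomp Require Import reals.

Set Implicit Arguments.
Unset Strict Implicit.
Unset Printing Implicit Defensive.

Import Order.TTheory GRing.Theory Num.Theory.
Local Open Scope classical_set_scope.
Local Open Scope ring_scope.

(* An element of [extform R n] is a polynomial differential form
   \sum_I w_I dx_I on C^n, the dx_i in dx_I being taken in increasing order. *)
Notation extform R n := {ffun {set 'I_n} -> {mpoly (complex R)[n]}}.
(* Formal power series in n variables, as families of coefficients. *)
Notation pseries R n := ('X_{1..n} -> complex R).

Section LinearFreeDivisors.
Context {R : realType} {n : nat}.
Local Notation C := (complex R).
Local Notation cpoly := {mpoly C[n]}.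
Implicit Types (h f p : cpoly).

Definition mdvd (p q : cpoly) : Prop := exists r : cpoly, q = r * p.

Definition lie (chi : 'I_n -> cpoly) (p : cpoly) : cpoly :=
  \sum_i chi i * p^`M(i).

Definition derlog h (chi : 'I_n -> cpoly) : Prop := mdvd h (lie chi h).

(* The last clause says that [b 0], ..., [b (n-1)] is a basis of Der(-log D);
   Der(-log D) has rank n, since it contains h * Der. *)
Definition linear_free_divisor h : Prop :=
  [/\ (1 < msize h)%N,
      forall (p : cpoly) (k : nat), mdvd h (p ^+ k) -> mdvd h p
    & exists b : 'I_n -> 'I_n -> cpoly,
        [/\ forall j i, b j i \is 1.-homog,
            forall j, derlog h (b j)
          & forall chi, derlog h chi ->
              exists! a : {ffun 'I_n -> cpoly},
                forall i, chi i = \sum_j a j * b j i]].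

End LinearFreeDivisors.

Section Germs.
Context {R : realType} {n : nat}.
Local Notation C := (complex R).
Local Notation cpoly := {mpoly C[n]}.
Implicit Types (a b : pseries R n) (h f : cpoly).

(* O_{C^n,0} consists of the series satisfying [convergent]. *)
Definition convergent a : Prop :=
  exists K r : R, forall m, `|a m| <= real_complex R (K * r ^+ mdeg m).

Definition ps_of_mpoly (p : cpoly) : pseries R n := fun m => p@_m.

Definition psmul a b : pseries R n := fun m =>
  \sum_(k : 'X_{1..n < (mdeg m).+1, (mdeg m).+1} | m == (k.1 + k.2)%MM)
     a k.1 * b k.2.

Definition psconst (c : C) : pseries R n :=
  fun m => if m == 0%MM then c else 0.

Definition psderiv (i : 'I_n) a : pseries R n :=
  fun m => a (m + U_(i))%MM *+ (m i).+1.

Definition ps_at0 a : C := a 0%MM.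

(* [T1_zero h f p]: the germ p lies in df(Der(-log h)) + (h). A germ of vector
   field chi with chi(h) = 0 is automatically in Der(-log D). *)
Definition T1_zero h f (p : pseries R n) : Prop :=
  exists (chi : 'I_n -> pseries R n) (q : pseries R n),
    [/\ forall i, convergent (chi i), convergent q,
        \sum_i psmul (chi i) (ps_of_mpoly h^`M(i)) = 0
      & p = \sum_i psmul (chi i) (ps_of_mpoly f^`M(i))
            + psmul q (ps_of_mpoly h)].

Definition Rh_finite h f : Prop :=
  exists (m : nat) (v : 'I_m -> pseries R n),
    (forall i, convergent (v i)) /\
    (forall p, convergent p ->
       exists c : 'I_m -> C, T1_zero h f (p - \sum_i c i *: v i)).

Definition T1_basis h f (g : 'I_n -> cpoly) : Prop :=
  (forall p, convergent p ->
     exists c : 'I_n -> C,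
       T1_zero h f (p - \sum_i c i *: ps_of_mpoly (g i))) /\
  (forall c : 'I_n -> C,
     T1_zero h f (\sum_i c i *: ps_of_mpoly (g i)) -> forall i, c i = 0).

End Germs.

Section Forms.
Context {R : realType} {n : nat}.
Local Notation C := (complex R).
Local Notation cpoly := {mpoly C[n]}.
Implicit Types (h f p : cpoly) (w : extform R n) (I J K : {set 'I_n}).

Definition inversions I J : nat :=
  #|[set ij : 'I_n * 'I_n | [&& ij.1 \in I, ij.2 \in J & (ij.2 < ij.1)%N]]|.

Definition wedge (v w : extform R n) : extform R n :=
  [ffun K : {set 'I_n} =>
     \sum_(I : {set 'I_n} | I \subset K)
        (-1) ^+ inversions I (K :\: I) * v I * w (K :\: I)].

Definition dfun p : extform R n :=
  [ffun K : {set 'I_n} => \sum_(i | K == [set i]%SET) p^`M(i)].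

Definition dform w : extform R n :=
  [ffun K : {set 'I_n} =>
     \sum_(i in K)
        (-1) ^+ inversions [set i]%SET (K :\ i) * (w (K :\ i)%SET)^`M(i)].

Definition fmul p w : extform R n := [ffun I => p * w I].

(* [codegree c w]: w is a form of degree n - c. In particular w = 0 if n < c. *)
Definition codegree (c : nat) w : Prop :=
  forall I, (#|I| + c)%N != n -> w I = 0.

(* A logarithmic form omega is encoded by its numerator w = h * omega: omega is
   logarithmic when h * omega = w and h * d(omega) = dw - (dh /\ w) / h are
   regular. *)
Definition log_form h (c : nat) w : Prop :=
  codegree c w /\ forall K, mdvd h (wedge (dfun h) w K).

(* The logarithmic form with numerator w is homogeneous of weight k, where h
   has degree n. *)
Definition has_weight (k : int) w : Prop :=
  forall I m, m \in msupp (w I) -> (mdeg m)%:Z + #|I|%:Z - n%:Z = k.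

End Forms.

(* A Laurent polynomial in tau (resp. in tau and t) with coefficients in V is
   a finitely supported function int -> V (resp. int -> int -> V), the value
   at i (resp. at i j) being the coefficient of tau^i (resp. tau^i t^j). *)
Section Laurent.
Context {V : zmodType}.

Definition finsupp1 (a : int -> V) : Prop :=
  exists N : nat, forall i : int, (N < absz i)%N -> a i = 0.

Definition finsupp2 (a : int -> int -> V) : Prop :=
  exists N : nat, forall i j : int,
    (N < absz i)%N || (N < absz j)%N -> a i j = 0.

Definition tau_mul (a : int -> V) : int -> V := fun i => a (i - 1).
Definition tau_mul2 (a : int -> int -> V) : int -> int -> V :=
  fun i j => a (i - 1) j.
Definition t_mul2 (a : int -> int -> V) : int -> int -> V :=
  fun i j => a i (j - 1).

Definition ddtau (a : int -> V) : int -> V := fun i => a (i + 1) *~ (i + 1).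

Definition tau0 (v : V) : int -> V := fun i => if i == 0 then v else 0.
Definition t0 (a : int -> V) : int -> int -> V :=
  fun i j => if j == 0 then a i else 0.

End Laurent.

Definition polytau {R : realType} {V : lmodType (complex R)}
    (p : {poly complex R}) (a : int -> V) : int -> V :=
  fun i => \sum_(j < size p) p`_j *: a (i - j%:Z).

(* [quot_dim A B k]: dim A / B = k, where B is a subspace of A. *)
Definition quot_dim {R : realType} {W : lmodType (complex R)}
    (A B : set W) (k : nat) : Prop :=
  exists v : 'I_k -> W,
    [/\ forall i, A (v i),
        forall a, A a -> exists c : 'I_k -> complex R, B (a - \sum_i c i *: v i)
      & forall c : 'I_k -> complex R,
          B (\sum_i c i *: v i) -> forall i, c i = 0].

Section GaussManin.
Context {R : realType} {n : nat}.
Local Notation C := (complex R).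
Local Notation cpoly := {mpoly C[n]}.
Local Notation form := (extform R n).
Implicit Types (h f : cpoly) (t : C).

(* Numerators of Laurent polynomials in tau (resp. in tau and t) whose
   coefficients are logarithmic (n - c)-forms. *)
Definition log_tau h (c : nat) (a : int -> form) : Prop :=
  finsupp1 a /\ forall i, log_form h c (a i).
Definition log_tau_t h (c : nat) (a : int -> int -> form) : Prop :=
  finsupp2 a /\ forall i j, log_form h c (a i j).

(* The modules are given by representatives, together with the submodule of
   the representatives of zero.

   [GMt_zero h f t a]: a represents 0 in G_t = G / (h - t) G (bold G), i.e. a
   is the sum of (d - tau df /\) b, an element of
   dh/h /\ Omega^{n-2}(log D)[tau^{+-1}], and (h - t) e. In terms of numerators,
   and multiplied by h, these are
   h db - dh /\ b - tau h df /\ b,  dh /\ z  and  h (h - t) e. *)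
Definition GMt_zero h f t (a : int -> form) : Prop :=
  exists b z e : int -> form,
    [/\ log_tau h 2 b, log_tau h 2 z, log_tau h 1 e
      & forall i : int,
          fmul h (a i) =
            fmul h (dform (b i)) - wedge (dfun h) (b i)
            - fmul h (wedge (dfun f) (b (i - 1)))
            + wedge (dfun h) (z i)
            + fmul h (fmul (h - t%:MP) (e i))].

(* [GMloc_zero h f a]: a represents 0 in G[t^{-1}], presented as the quotient
   of Omega^{n-1}(log h)[tau^{+-1}, t^{+-1}] by the images of d - tau df /\ and
   of t - h. *)
Definition GMloc_zero h f (a : int -> int -> form) : Prop :=
  exists b z e : int -> int -> form,
    [/\ log_tau_t h 2 b, log_tau_t h 2 z, log_tau_t h 1 e
      & forall i j : int,
          fmul h (a i j) =
            fmul h (dform (b i j)) - wedge (dfun h) (b i j)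
            - fmul h (wedge (dfun f) (b (i - 1) j))
            + wedge (dfun h) (z i j)
            + fmul h (e i (j - 1) - fmul h (e i j))].

Definition nabla_tau f (a : int -> form) : int -> form :=
  fun i => ddtau a i - fmul f (a i).

(* [Glat h f t k] is tau^k G_t: the classes in bold G_t of elements of
   tau^k Omega^{n-1}(log h)[tau^{-1}]. *)
Definition Glat h f t (k : int) : set (int -> form) :=
  [set a | log_tau h 1 a /\
     exists a', [/\ log_tau h 1 a', forall i, k < i -> a' i = 0
                  & GMt_zero h f t (a - a')]].

(* The Kashiwara-Malgrange filtration at tau = 0, each V b being given as a
   set of representatives. *)
Record KM_filtration h f t (V : rat -> set (int -> form)) : Prop := {
  km_log : forall b a, V b a -> log_tau h 1 a;
  km_zero : forall b a, log_tau h 1 a -> GMt_zero h f t a -> V b a;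
  km_lin : forall b (c : C) a a', V b a -> V b a' -> V b (c *: a + a');
  km_incr : forall b b' a, b <= b' -> V b a -> V b' a;
  km_exhaustive : forall a, log_tau h 1 a -> exists b, V b a;
  (* finite generation over C[tau] *)
  km_fg : forall b, exists (m : nat) (v : 'I_m -> int -> form),
    (forall k, V b (v k)) /\
    (forall a, V b a -> exists p : 'I_m -> {poly C},
       GMt_zero h f t (a - \sum_k polytau (p k) (v k)));
  km_tau : forall b a, log_tau h 1 a -> (V b a <-> V (b - 1) (tau_mul a));
  km_stable : forall b a, V b a -> V b (tau_mul (nabla_tau f a));
  km_nilp : forall b, exists N : nat, forall a, V b a ->
    exists2 b', b' < b &
      V b' (iter N (fun x => tau_mul (nabla_tau f x) + ratr b *: x) a);
  (* the jumps lie in r^{-1} Z, and V is right-continuous *)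
  km_jumps : exists2 r : nat, (0 < r)%N &
    forall b b', b <= b' ->
      (forall k : int, ~ (b < k%:~R / r%:R /\ k%:~R / r%:R <= b')) ->
      forall a, V b' a -> V b a
}.

Definition Vlt (V : rat -> set (int -> form)) (b : rat) : set (int -> form) :=
  [set a | exists2 b', b' < b & V b' a].

Definition spectral_mult h f t (V : rat -> set (int -> form)) (b : rat)
    (k : nat) : Prop :=
  quot_dim (V b `&` Glat h f t 0)
    [set a | exists x y : int -> form,
       [/\ (Vlt V b `&` Glat h f t 0) x,
           (Glat h f t (-1) `&` V b) y & a = x + y]] k.

Definition min_spectral_simple h f t (V : rat -> set (int -> form)) : Prop :=
  exists alpha : rat, spectral_mult h f t V alpha 1 /\
    forall b, b < alpha -> spectral_mult h f t V b 0.

Definition pairing_t : Type := (int -> form) -> (int -> form) -> int -> C.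
Definition pairing_loc : Type :=
  (int -> int -> form) -> (int -> int -> form) -> int -> int -> C.

(* A C-bilinear pairing of bold G_t with its conjugate, linear over
   C[tau^{+-1}]; tau acts on the conjugate as - tau. *)
Record is_pairing_t h f t (P : pairing_t) : Prop := {
  pt_fin : forall a b, log_tau h 1 a -> log_tau h 1 b -> finsupp1 (P a b);
  pt_linl : forall (c : C) a a' b,
    log_tau h 1 a -> log_tau h 1 a' -> log_tau h 1 b ->
    P (c *: a + a') b = c *: P a b + P a' b;
  pt_linr : forall (c : C) a b b',
    log_tau h 1 a -> log_tau h 1 b -> log_tau h 1 b' ->
    P a (c *: b + b') = c *: P a b + P a b';
  pt_taul : forall a b, log_tau h 1 a -> log_tau h 1 b ->
    P (tau_mul a) b = tau_mul (P a b);
  pt_taur : forall a b, log_tau h 1 a -> log_tau h 1 b ->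
    P a (tau_mul b) = - tau_mul (P a b);
  pt_zerol : forall a b, log_tau h 1 a -> log_tau h 1 b ->
    GMt_zero h f t a -> P a b = 0;
  pt_zeror : forall a b, log_tau h 1 a -> log_tau h 1 b ->
    GMt_zero h f t b -> P a b = 0
}.

Record is_pairing_loc h f (S : pairing_loc) : Prop := {
  pl_fin : forall a b, log_tau_t h 1 a -> log_tau_t h 1 b -> finsupp2 (S a b);
  pl_linl : forall (c : C) a a' b,
    log_tau_t h 1 a -> log_tau_t h 1 a' -> log_tau_t h 1 b ->
    S (c *: a + a') b = c *: S a b + S a' b;
  pl_linr : forall (c : C) a b b',
    log_tau_t h 1 a -> log_tau_t h 1 b -> log_tau_t h 1 b' ->
    S a (c *: b + b') = c *: S a b + S a b';
  pl_taul : forall a b, log_tau_t h 1 a -> log_tau_t h 1 b ->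
    S (tau_mul2 a) b = tau_mul2 (S a b);
  pl_taur : forall a b, log_tau_t h 1 a -> log_tau_t h 1 b ->
    S a (tau_mul2 b) = - tau_mul2 (S a b);
  pl_tl : forall a b, log_tau_t h 1 a -> log_tau_t h 1 b ->
    S (t_mul2 a) b = t_mul2 (S a b);
  pl_tr : forall a b, log_tau_t h 1 a -> log_tau_t h 1 b ->
    S a (t_mul2 b) = t_mul2 (S a b);
  pl_zerol : forall a b, log_tau_t h 1 a -> log_tau_t h 1 b ->
    GMloc_zero h f a -> S a b = 0;
  pl_zeror : forall a b, log_tau_t h 1 a -> log_tau_t h 1 b ->
    GMloc_zero h f b -> S a b = 0
}.

(* The properties of the pairing provided by Sabbah for tame functions. *)
Record sabbah_pairing h f t (V : rat -> set (int -> form)) (P : pairing_t) :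
    Prop := {
  sp_pairing : is_pairing_t h f t P;
  (* on the conjugate, nabla_tau acts as - nabla_tau *)
  sp_flat : forall a b, log_tau h 1 a -> log_tau h 1 b ->
    ddtau (P a b) = P (nabla_tau f a) b - P a (nabla_tau f b);
  (* Hermitian with respect to tau |-> - tau. The sign (-1)^(n-1) is the one
     for which the leading term at tau^(1-n) is symmetric on G_t. *)
  sp_hermitian : forall a b, log_tau h 1 a -> log_tau h 1 b ->
    forall i, P b a i = (-1) ^+ (n.-1 + absz i) * P a b i;
  sp_nondeg : forall a, log_tau h 1 a ->
    (forall b, log_tau h 1 b -> P a b = 0) -> GMt_zero h f t a;
  sp_V : forall a b, V 0 a -> Vlt V 1 b -> forall i, i < 0 -> P a b i = 0;
  sp_G : forall a b, Glat h f t 0 a -> Glat h f t 0 b ->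
    forall i, 1 - n%:Z < i -> P a b i = 0;
  sp_lead_sym : forall a b, Glat h f t 0 a -> Glat h f t 0 b ->
    P a b (1 - n%:Z) = P b a (1 - n%:Z);
  sp_lead_nondeg : forall a, Glat h f t 0 a ->
    (forall b, Glat h f t 0 b -> P a b (1 - n%:Z) = 0) -> Glat h f t (-1) a
}.

(* Homogeneity of degree k for deg tau = -1, deg t = n. *)
Definition homog_loc (k : int) (a : int -> int -> form) : Prop :=
  forall i j : int, has_weight (k + i - n%:Z * j) (a i j).

Record hypothesis_H h f (P : C -> pairing_t) (S : pairing_loc) : Prop := {
  H_pairing : is_pairing_loc h f S;
  H_induces : forall t, t != 0 -> forall a b, log_tau h 1 a -> log_tau h 1 b ->
    forall i, P t a b i = \sum_(j \in [set: int]) S (t0 a) (t0 b) i j * t ^ j;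
  H_homog : forall k l a b, log_tau_t h 1 a -> log_tau_t h 1 b ->
    homog_loc k a -> homog_loc l b ->
    forall i j, S a b i j != 0 -> n%:Z * j - i = k + l;
  H_G : forall a b, log_tau h 1 a -> log_tau h 1 b ->
    (forall i, 0 < i -> a i = 0) -> (forall i, 0 < i -> b i = 0) ->
    forall i j, S (t0 a) (t0 b) i j != 0 -> i <= 1 - n%:Z /\ 0 <= j
}.

End GaussManin.

Section FrobeniusGerms.
Context {R : realType} {n : nat}.
Local Notation C := (complex R).
Local Notation cpoly := {mpoly C[n]}.
Local Notation series := (pseries R n).
Local Notation D := psderiv.
Local Infix "**" := psmul (at level 40, left associativity).

(* Tensors on the germ (C^n, 0) with coordinates u_1, ..., u_n, in the frame
   d_i = d/du_i: the metric g(d_i, d_j), the product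
   d_i o d_j = \sum_k (fmult i j k) d_k, the unit and Euler fields, and the
   Levi-Civita connection nabla_{d_i} d_j = \sum_k (fconn i j k) d_k. *)
Record frobenius_data := FrobeniusData {
  fmetric : 'I_n -> 'I_n -> series;
  fmult : 'I_n -> 'I_n -> 'I_n -> series;
  funit : 'I_n -> series;
  feuler : 'I_n -> series;
  fconn : 'I_n -> 'I_n -> 'I_n -> series
}.

Record is_frobenius (F : frobenius_data)
    (g := fmetric F) (A := fmult F) (e := funit F) (E := feuler F)
    (G := fconn F) : Prop := {
  fr_hol : [/\ forall i j, convergent (g i j),
               forall i j k, convergent (A i j k),
               forall i, convergent (e i), forall i, convergent (E i)
             & forall i j k, convergent (G i j k)];
  fr_metric_sym : forall i j, g i j = g j i;
  fr_metric_nondeg : \det (\matrix_(i, j) ps_at0 (g i j)) != 0;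
  fr_comm : forall i j k, A i j k = A j i k;
  fr_assoc : forall i j k l,
    \sum_m A i j m ** A m k l = \sum_m A j k m ** A i m l;
  fr_unit : forall j k,
    \sum_i e i ** A i j k = psconst (if j == k then 1 else 0);
  fr_invariant : forall i j k,
    \sum_m A i j m ** g m k = \sum_m A j k m ** g i m;
  fr_torsion : forall i j k, G i j k = G j i k;
  fr_levi_civita : forall k i j,
    D k (g i j) = \sum_l (G k i l ** g l j + G k j l ** g i l);
  fr_flat : forall i j k l,
    D i (G j k l) + \sum_m G j k m ** G i m l =
    D j (G i k l) + \sum_m G i k m ** G j m l;
  fr_unit_flat : forall i k, D i (e k) + \sum_j e j ** G i j k = 0;
  (* nabla A is symmetric *)
  fr_potentiality : forall i j k l,
    let nablaA i j k l :=
      D i (A j k l) + \sum_m (A j k m ** G i m l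
                              - G i j m ** A m k l - G i k m ** A j m l) in
    nablaA i j k l = nablaA j i k l;
  (* Lie_E A = A and Lie_E g = c g *)
  fr_euler_mult : forall i j k,
    \sum_m (E m ** D m (A i j k) - A i j m ** D m (E k)
            + D i (E m) ** A m j k + D j (E m) ** A i m k) = A i j k;
  fr_euler_metric : exists c : C, forall i j,
    \sum_m (E m ** D m (g i j) + D i (E m) ** g m j + D j (E m) ** g i m) =
    c *: g i j
}.

(* There are coordinates s_1, ..., s_n vanishing at the origin in which the
   metric is the constant matrix eta (flat coordinates), the structure
   constants are the constants c, and the potential, i.e. a function with
   third derivatives g(d_a o d_b, d_c), is a polynomial of degree <= 3 in s. *)
Definition frobenius_constant (F : frobenius_data) : Prop :=
  exists (s : 'I_n -> series) (eta : 'M[C]_n) (c : 'I_n -> 'I_n -> 'I_n -> C)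
         (Phi : cpoly),
    [/\ forall a, convergent (s a) /\ ps_at0 (s a) = 0,
        \det (\matrix_(i, a) ps_at0 (D i (s a))) != 0,
        forall i j, fmetric F i j =
          \sum_a \sum_b eta a b *: (D i (s a) ** D j (s b)),
        forall i j k, \sum_l fmult F i j l ** D l (s k) =
          \sum_a \sum_b c a b k *: (D i (s a) ** D j (s b))
      & (msize Phi <= 4)%N /\
        forall a b k,
          (Phi^`M(a))^`M(b)^`M(k) = (\sum_l c a b l * eta l k)%:MP].

(* [T1_iso h f w]: p |-> p * (class of w) induces an isomorphism from T^1 f to
   G_0 / tau^{-1} G_0, where w is the numerator of a logarithmic form. *)
Definition T1_iso (h f : cpoly) (w : extform R n) : Prop :=
  [/\ log_form h 1 w,
      forall p : cpoly,
        T1_zero h f (ps_of_mpoly p) <-> Glat h f 0 (-1) (tau0 (fmul p w))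
    & forall a, Glat h f 0 0 a ->
        exists p : cpoly, Glat h f 0 (-1) (a - tau0 (fmul p w))].

(* F is a structure on the base M_0 = (C^n, 0) of the unfolding
   f + \sum_i u_i g_i: for the identification d_i |-> [g_i] of T_0 M_0 with
   T^1 f, the product at 0 is the multiplication of T^1 f; and for an
   isomorphism T^1 f = G_0 / tau^{-1} G_0 given by a generator of the latter,
   the metric at 0 is the pairing induced by S, i.e. the coefficient of
   tau^(1-n) t^0. *)
Definition frobenius_on_base (h f : cpoly) (g : 'I_n -> cpoly)
    (S : @pairing_loc R n) (F : frobenius_data) : Prop :=
  (forall i j, T1_zero h f
     (ps_of_mpoly (g i * g j)
      - \sum_k ps_at0 (fmult F i j k) *: ps_of_mpoly (g k))) /\
  (exists2 w, T1_iso h f w &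
     forall i j, ps_at0 (fmetric F i j) =
       S (t0 (tau0 (fmul (g i) w))) (t0 (tau0 (fmul (g j) w)))
         (1 - n%:Z) 0).

End FrobeniusGerms.

(* Main.v *)
Require Import Defs.
From mathcomp Require Import all_boot all_order all_algebra.
From mathcomp Require Import complex mpoly.
From mathcomp Require Import boolp classical_sets functions reals.
From mathcomp Require Import cardinality fsbigop ring zify.

Set Implicit Arguments.
Unset Strict Implicit.
Unset Printing Implicit Defensive.

Import Order.TTheory GRing.Theory Num.Theory.
Local Open Scope ring_scope.

(** The Frobenius structure has constant metric, product and unit in the
   coordinates u_i, and Euler field sum u_i d_i; what has to be shown is that
   T^1 f with the form (p, q) |-> Q(p, q), the leading coefficient at t = 0 of
   S(p w, q w), is a Frobenius algebra, w being the contraction of vol/h by the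
   Euler field.

   Comparing the homogeneous components of h under a linear basis of
   Der(-log D) shows that h is homogeneous. As C is algebraically closed and
   T^1 f is finite dimensional, df(Der(-log h)) vanishes exactly on a line,
   which is not contained in D. Hence 1, f, ..., f^(n-1) span
   O / (df(Der(-log h)) + (h - t)) for all t, h having degree n (for n = 1 the
   coordinate replaces f). The relations (d - tau df) b = 0 show that these
   powers also span G_t / tau^-1 G_t.

   By homogeneity Q(f^i, f^j) vanishes unless i + j = n - 1, and there it is
   the leading coefficient of the pairing on G_1; flatness of that pairing
   makes multiplication by f self-adjoint, so Q(p, q) = Q(1, p q). If
   Q(1, f^(n-1)) were zero, the leading form on G_1 would vanish, whence
   G_1 = tau^-1 G_1 and the spectrum would be empty. Finally, elements of
   tau^-1 G_0 are Q-orthogonal to everything, which also shows that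
   T^1 f -> G_0 / tau^-1 G_0 is injective. *)

(** * Homogeneous components of power series *)

Section Components.
Context {R : realType} {n : nat}.
Local Notation C := (complex R).
Local Notation cpoly := {mpoly C[n]}.
Local Notation ps := (@ps_of_mpoly R n).
Implicit Types (p q h f : cpoly) (a b : pseries R n) (chi : 'I_n -> cpoly).

Lemma mdvd_mulr h p q : mdvd h p -> mdvd h (p * q).
Proof. by case=> r ->; exists (r * q); rewrite mulrAC. Qed.

Lemma mdvd_mull h p q : mdvd h p -> mdvd h (q * p).
Proof. by rewrite mulrC; exact: mdvd_mulr. Qed.

Lemma mdvdD h p q : mdvd h p -> mdvd h q -> mdvd h (p + q).
Proof. by case=> r -> [s ->]; exists (r + s); rewrite mulrDl. Qed.

Lemma mdvd0 h : mdvd h 0.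
Proof. by exists 0; rewrite mul0r. Qed.

Lemma mdvdN h p : mdvd h p -> mdvd h (- p).
Proof. by case=> r ->; exists (- r); rewrite mulNr. Qed.

(** A component of a series is a polynomial, so equations between germs can be read as polynomial
    equations degree by degree. *)
Definition hcomp (k : nat) a : cpoly :=
  \sum_(m : 'X_{1..n < k.+1}) (if mdeg m == k then a m else 0) *: 'X_[m].

Lemma mcoeff_hcomp k a m : (hcomp k a)@_m = if mdeg m == k then a m else 0.
Proof.
have [lt_mk|ge_mk] := ltnP (mdeg m) k.+1.
  by rewrite /hcomp (mcoeff_mpoly (fun m => if mdeg m == k then a m else 0)).
rewrite ifF; last by apply/negbTE; rewrite neq_ltn ge_mk orbT.
rewrite /hcomp raddf_sum /= big1 // => i _.
rewrite mcoeffZ mcoeffX; case: (eqVneq (i : 'X_{1..n}) m) => [im|_].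
  2: by rewrite mulr0.
by move: ge_mk (bmdeg i); rewrite -im leqNgt => /negbTE ->.
Qed.

Lemma hcompD k a b : hcomp k (a + b) = hcomp k a + hcomp k b.
Proof.
by apply/mpolyP=> m; rewrite mcoeffD !mcoeff_hcomp; case: eqP; rewrite ?addr0.
Qed.

Lemma hcomp0 k : hcomp k 0 = 0.
Proof. by apply/mpolyP=> m; rewrite mcoeff0 mcoeff_hcomp; case: eqP. Qed.

Lemma hcomp_sum k I (r : seq I) (F : I -> pseries R n) :
  hcomp k (\sum_(i <- r) F i) = \sum_(i <- r) hcomp k (F i).
Proof. by elim/big_rec2: _ => [|i y x _ <-]; rewrite ?hcomp0 ?hcompD. Qed.

Lemma hcomp_homog k a : hcomp k a \is k.-homog.
Proof.
apply/dhomogP => m; rewrite mcoeff_msupp mcoeff_hcomp.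
by case: (eqVneq (mdeg m) k) => //; rewrite eqxx.
Qed.

Lemma hcomp_ps_homog d k p : p \is d.-homog ->
  hcomp k (ps p) = if k == d then p else 0.
Proof.
move=> pH; apply/mpolyP => m; rewrite mcoeff_hcomp /ps_of_mpoly.
case: (eqVneq (mdeg m) d) => [<-|md].
  by rewrite eq_sym; case: eqP; rewrite ?mcoeff0.
by do 2 case: ifP => _; rewrite ?mcoeff0 ?(dhomog_nemf_coeff pH md).
Qed.

(** Only the component of degree [k - d] of the series meets a factor homogeneous of degree d. *)
Lemma hcomp_psmul d k a p : p \is d.-homog ->
  hcomp k (psmul a (ps p)) = if (d <= k)%N then hcomp (k - d) a * p else 0.
Proof.
move=> pH; apply/mpolyP => m; rewrite mcoeff_hcomp.
have key (c1 c2 : 'X_{1..n}) : mdeg c2 != d -> p@_c2 = 0.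
  exact: dhomog_nemf_coeff.
have [le_dk|lt_kd] := leqP d k; last first.
  rewrite mcoeff0; case: eqP => // mk; rewrite /psmul big1 // => c /eqP mE.
  rewrite /ps_of_mpoly key ?mulr0 //; apply: contraTneq lt_kd => c2d.
  by rewrite -leqNgt -mk mE mdegD c2d leq_addl.
case: eqP => [mk|/eqP mk]; last first.
  have := dhomogM (hcomp_homog (k - d) a) pH; rewrite subnK // => H.
  by rewrite (dhomog_nemf_coeff H).
rewrite mcoeffM /psmul; apply: eq_bigr => c /eqP mE.
rewrite /ps_of_mpoly mcoeff_hcomp; case: (eqVneq (mdeg c.2) d) => [c2d|/key->//].
  by rewrite ifT // -mk [in X in (_ == X - _)%N]mE mdegD c2d addnK.
by rewrite !mulr0.
Qed.

Lemma sum_hcomp p : p = \sum_(k < msize p) hcomp k (ps p).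
Proof.
apply/mpolyP=> m; rewrite raddf_sum /=.
have [lt_m|ge_m] := ltnP (mdeg m) (msize p).
  rewrite (bigD1 (Ordinal lt_m)) //= mcoeff_hcomp eqxx big1 ?addr0 // => i ne.
  by rewrite mcoeff_hcomp ifN // eq_sym.
rewrite memN_msupp_eq0 ?msize_mdeg_ge // big1 // => i _.
by rewrite mcoeff_hcomp ifN // neq_ltn (leq_trans (ltn_ord i) ge_m) orbT.
Qed.

(** * Polynomials as convergent power series *)

Lemma psD p q : ps (p + q) = ps p + ps q.
Proof. by apply/funext=> m; rewrite /ps_of_mpoly mcoeffD. Qed.
Lemma ps0 : ps 0 = 0.
Proof. by apply/funext=> m; rewrite /ps_of_mpoly mcoeff0. Qed.
Lemma psB p q : ps (p - q) = ps p - ps q.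
Proof. by apply/funext=> m; rewrite /ps_of_mpoly mcoeffB. Qed.
Lemma psZ (c : C) p : ps (c *: p) = c *: ps p.
Proof. by apply/funext=> m; rewrite /ps_of_mpoly mcoeffZ. Qed.
Lemma ps_sum I (r : seq I) (F : I -> cpoly) :
  ps (\sum_(i <- r) F i) = \sum_(i <- r) ps (F i).
Proof. by elim/big_rec2: _ => [|i y x _ <-]; rewrite ?ps0 ?psD. Qed.
Lemma psM p q : psmul (ps p) (ps q) = ps (p * q).
Proof. by apply/funext=> m; rewrite /ps_of_mpoly mcoeffM. Qed.
Lemma ps_deriv i p : psderiv i (ps p) = ps p^`M(i).
Proof. by apply/funext=> m; rewrite /psderiv /ps_of_mpoly mcoeff_deriv. Qed.
Lemma ps_const (c : C) : psconst c = ps c%:MP.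
Proof.
apply/funext=> m; rewrite /psconst /ps_of_mpoly mcoeffC eq_sym.
by case: eqP; rewrite ?mulr1 ?mulr0.
Qed.

Lemma normc_ge0 (z : C) : 0 <= Normc.normc z.
Proof. by case: z => x y; rewrite sqrtr_ge0. Qed.

Lemma ps_convergent p : convergent (ps p).
Proof.
pose K : R := \sum_(m <- msupp p) Normc.normc p@_m.
exists K, 1 => m; rewrite expr1n mulr1 -[`|_|]/((Normc.normc _)%:C)%C lecR.
rewrite /ps_of_mpoly.
have [ms|ms] := boolP (m \in msupp p); last first.
  rewrite memN_msupp_eq0 // Normc.normc0 /K sumr_ge0 // => i _.
  exact: normc_ge0.
rewrite /K (bigD1_seq m) //= lerDl sumr_ge0 // => i _.
exact: normc_ge0.
Qed.

(** * Derivatives of forms and the Euler identity *)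

Lemma mderiv_X (i j : 'I_n) : ('X_i : cpoly)^`M(j) = (i == j)%:R.
Proof.
rewrite mderivX mnm1E; case: eqP => [->|_]; last by rewrite scale0r.
by rewrite scale1r -{1}[U_(j)%MM]add0m addmK mpolyX0.
Qed.

Lemma deriv_homog d i p : p \is d.+1.-homog -> p^`M(i) \is d.-homog.
Proof.
move=> pH; apply/dhomogP => m; rewrite mcoeff_msupp mcoeff_deriv.
case: (eqVneq (mdeg m) d) => // md.
rewrite (dhomog_nemf_coeff pH) ?mul0rn ?eqxx //.
by rewrite /= mdegD mdeg1 addn1 eqSS.
Qed.

Lemma deriv0_homog i p : p \is 0.-homog -> p^`M(i) = 0.
Proof.
move=> pH; apply/mpolyP => m; rewrite mcoeff_deriv mcoeff0.
by rewrite (dhomog_nemf_coeff pH) ?mul0rn //= mdegD mdeg1 addn1.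
Qed.

Lemma lin_deriv i p : p \is 1.-homog -> exists c : C, p^`M(i) = c%:MP.
Proof.
move=> pH; exists (p^`M(i))@_0; apply: msize1_polyC.
have /dhomogP := @deriv_homog 0 i p pH.
rewrite msizeE => H; apply/bigmax_leqP_seq => m ms _; by rewrite H.
Qed.

(** Monomials are eigenvectors of the Euler operator, with their degree as eigenvalue. *)
Lemma mcoeff_euler p m :
  (\sum_i 'X_i * p^`M(i))@_m = (mdeg m)%:R * p@_m.
Proof.
have mono (m' : 'X_{1..n}) :
    \sum_i 'X_i * ('X_[m'] : cpoly)^`M(i) = (mdeg m')%:R *: 'X_[m'].
  under eq_bigr => i _ do rewrite mderivX -scalerAr -mpolyXD.
  rewrite mdegE natr_sum scaler_suml; apply: eq_bigr => i _.
  have [->|mi] := posnP (m' i); first by rewrite !scale0r.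
  by congr (_ *: 'X_[_]); rewrite addmC submK // lep1mP -lt0n.
have -> : \sum_i 'X_i * p^`M(i) =
    \sum_(m' <- msupp p) ((mdeg m')%:R * p@_m') *: 'X_[m'].
  rewrite {1}(mpolyE p); under eq_bigr => i _ do rewrite raddf_sum mulr_sumr.
  rewrite exchange_big; apply: eq_bigr => m' _ /=.
  under eq_bigr => i _ do rewrite mderivZ -scalerAr.
  by rewrite -scaler_sumr mono !scalerA mulrC.
rewrite [in RHS](mpolyE p) !(raddf_sum (mcoeff m)) mulr_sumr /=.
apply: eq_bigr => m' _.
rewrite !mcoeffZ mcoeffX; case: (eqVneq m' m) => [->|]; first by rewrite !mulr1.
by rewrite !mulr0.
Qed.

Lemma euler d p : p \is d.-homog -> \sum_i 'X_i * p^`M(i) = d%:R *: p.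
Proof.
move=> pH; apply/mpolyP => m; rewrite mcoeff_euler mcoeffZ.
have [->//|md] := eqVneq (mdeg m) d.
by rewrite (dhomog_nemf_coeff pH md) !mulr0.
Qed.

(** In characteristic zero the eigenvalue determines the degree of every monomial that occurs. *)
Lemma euler_homog d p : \sum_i 'X_i * p^`M(i) = d%:R *: p -> p \is d.-homog.
Proof.
move=> E; apply/dhomogP => m; rewrite mcoeff_msupp => pm.
move/(congr1 (fun q => q@_m)): E; rewrite mcoeff_euler mcoeffZ => /(mulIf pm).
by move/eqP; rewrite eqr_nat => /eqP.
Qed.

Lemma meval_linear (v : 'I_n -> C) p : p \is 1.-homog ->
  p.@[v] = \sum_i v i * (p^`M(i))@_0.
Proof.
move=> pH; have := euler pH; rewrite scale1r => {1}<-.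
rewrite raddf_sum /=; apply: eq_bigr => i _; rewrite mevalM mevalXU.
by have [c ->] := lin_deriv i pH; rewrite mevalC mcoeffC eqxx mulr1.
Qed.

(** * Vector fields acting on polynomials *)

Lemma lie_homog d k chi p :
  (forall i, chi i \is k.-homog) -> p \is d.+1.-homog ->
  lie chi p \is (k + d).-homog.
Proof.
move=> chiH pH; rewrite /lie; apply: rpred_sum => i _; apply: dhomogM => //.
exact: deriv_homog.
Qed.

Lemma lieMl p chi q : lie (fun i => p * chi i) q = p * lie chi q.
Proof. by rewrite /lie mulr_sumr; apply: eq_bigr => i _; rewrite mulrA. Qed.

Lemma lieDl chi1 chi2 q :
  lie (fun i => chi1 i + chi2 i) q = lie chi1 q + lie chi2 q.
Proof.
by rewrite /lie -big_split; apply: eq_bigr => i _; rewrite mulrDl.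
Qed.

Lemma lie_suml I (r : seq I) (P : pred I) (F : I -> 'I_n -> cpoly) q :
  lie (fun i => \sum_(j <- r | P j) F j i) q = \sum_(j <- r | P j) lie (F j) q.
Proof.
rewrite /lie exchange_big; apply: eq_bigr => i _ /=; exact: mulr_suml.
Qed.

Lemma lie_delta i p q :
  lie (fun k => if k == i then p else 0) q = p * q^`M(i).
Proof.
rewrite /lie (bigD1 i) //= eqxx big1 ?addr0 // => k /negbTE ->.
by rewrite mul0r.
Qed.

(** A linear vector field preserves degrees. For [k = 0], where [k - 1] truncates, both sides
    vanish. *)
Lemma lie_hcomp k (b : 'I_n -> cpoly) p : (forall i, b i \is 1.-homog) ->
  lie b (hcomp k (ps p)) = hcomp k (ps (lie b p)).
Proof.
move=> bH; rewrite /lie ps_sum hcomp_sum; apply: eq_bigr => i _.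
rewrite mulrC [in RHS]mulrC -psM.
rewrite (hcomp_psmul _ _ (bH i)); case: ltnP => k0.
  congr (_ * _); apply/mpolyP => m; rewrite mcoeff_deriv !mcoeff_hcomp.
  rewrite mdegD mdeg1 addn1 -(eqn_add2r 1 _ (k - 1)) subnK // addn1.
  by rewrite /ps_of_mpoly mcoeff_deriv; case: eqP; rewrite ?mul0rn.
move: k0; rewrite leqn0 => /eqP ->.
by rewrite (deriv0_homog _ (hcomp_homog 0 _)) mul0r.
Qed.

End Components.

(** * The ideal df(Der(-log h)) + (h - t) *)

Section Jacobian.
Context {R : realType} {n : nat}.
Local Notation C := (complex R).
Local Notation cpoly := {mpoly C[n]}.
Local Notation ps := (@ps_of_mpoly R n).
Implicit Types (p q h f l : cpoly) (chi : 'I_n -> cpoly) (t : C).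

(** Polynomial counterpart of [T1_zero] for [t = 0]; the other values of t give the ideal of f on
    the fibres of h. *)
Definition jac h f t p : Prop :=
  exists chi q, lie chi h = 0 /\ p = lie chi f + q * (h - t%:MP).

Lemma jac_lie h f t chi : lie chi h = 0 -> jac h f t (lie chi f).
Proof. by exists chi, 0; rewrite mul0r addr0. Qed.

Lemma lie0 p : lie (fun=> 0) p = 0 :> cpoly.
Proof. by rewrite /lie big1 // => i _; rewrite mul0r. Qed.

Lemma jac_h h f t q : jac h f t (q * (h - t%:MP)).
Proof. by exists (fun=> 0), q; rewrite !lie0 add0r. Qed.

Lemma jac0 h f t : jac h f t 0.
Proof. by have := jac_h h f t 0; rewrite mul0r. Qed.

Lemma jacM h f t p q : jac h f t p -> jac h f t (q * p).
Proof.
case=> chi [r [chih ->]]; exists (fun i => q * chi i), (q * r).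
by rewrite !lieMl chih mulr0 mulrDr mulrA.
Qed.

Lemma jacZ h f t (c : C) p : jac h f t p -> jac h f t (c *: p).
Proof. by rewrite -mul_mpolyC; exact: jacM. Qed.

Lemma jacD h f t p q : jac h f t p -> jac h f t q -> jac h f t (p + q).
Proof.
case=> chi1 [r1 [chih1 ->]] [chi2 [r2 [chih2 ->]]].
exists (fun i => chi1 i + chi2 i), (r1 + r2).
by rewrite !lieDl chih1 chih2 addr0 mulrDl addrACA.
Qed.

Lemma jacN h f t p : jac h f t p -> jac h f t (- p).
Proof. by rewrite -scaleN1r; exact: jacZ. Qed.

Lemma jacB h f t p q : jac h f t p -> jac h f t q -> jac h f t (p - q).
Proof. by move=> ? ?; apply: jacD => //; apply: jacN. Qed.

Lemma jac_sum h f t I (r : seq I) (P : pred I) (F : I -> cpoly) :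
  (forall i, P i -> jac h f t (F i)) -> jac h f t (\sum_(i <- r | P i) F i).
Proof. by move=> H; elim/big_rec: _ => [|i x /H]; [exact: jac0|exact: jacD]. Qed.

(** As f is linear and h homogeneous, the components of degree k of the coefficients of the germ of
    field form a polynomial field that still kills h. *)
Lemma T1_zero_hcomp d h f (a : pseries R n) k :
  h \is d.+1.-homog -> f \is 1.-homog -> T1_zero h f a ->
  exists chi q, lie chi h = 0 /\
    hcomp k a = lie chi f + (if (d < k)%N then q * h else 0).
Proof.
move=> hH fH [chi [q [_ _ chih ->]]].
exists (fun i => hcomp k (chi i)), (hcomp (k - d.+1) q); split.
  have /(congr1 (hcomp (k + d))) := chih; rewrite hcomp_sum hcomp0 => E.
  rewrite -[RHS]E; apply: eq_bigr => i _.
  by rewrite (hcomp_psmul _ _ (deriv_homog i hH)) leq_addl addnK.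
rewrite hcompD hcomp_sum (hcomp_psmul _ _ hH); congr (_ + _).
apply: eq_bigr => i _.
by rewrite (hcomp_psmul _ _ (deriv_homog i fH)) leq0n subn0.
Qed.

Lemma jac_T1_zero h f p : jac h f 0 p -> T1_zero h f (ps p).
Proof.
case=> chi [q [chih ->]].
exists (fun i => ps (chi i)), (ps q); split=> [i||//|].
- exact: ps_convergent.
- exact: ps_convergent.
- under eq_bigr => i _ do rewrite psM.
  by rewrite -ps_sum -[X in ps X]/(lie chi h) chih ps0.
under eq_bigr => i _ do rewrite psM.
by rewrite -ps_sum psM -psD mpolyC0 subr0.
Qed.

(** A polynomial is the finite sum of its components, and each of these lies in the polynomial
    ideal. *)
Lemma T1_zero_jac d h f p : h \is d.+1.-homog -> f \is 1.-homog ->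
  T1_zero h f (ps p) <-> jac h f 0 p.
Proof.
move=> hH fH; split=> [pT|]; last exact: jac_T1_zero.
rewrite (sum_hcomp p); apply: jac_sum => k _.
have [chi [q [chih ->]]] := T1_zero_hcomp k hH fH pT.
apply: jacD; first exact: jac_lie.
by case: ifP => _; [have := jac_h h f 0 q; rewrite subr0|exact: jac0].
Qed.

Lemma exists_left_kernel (a b : nat) (M : 'M[C]_(a, b)) : (b < a)%N ->
  exists2 c : 'rV_a, c != 0 & c *m M = 0.
Proof.
move=> ba; exists (nz_row (kermx M)).
  rewrite nz_row_eq0 -mxrank_eq0 mxrank_ker subn_eq0 -ltnNge.
  exact: leq_ltn_trans (rank_leq_col M) ba.
by apply/sub_kermxP; exact: nz_row_sub.
Qed.

(* A family of linear vector fields b_j spanning Der(-log h) necessarily acts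
   on h by constants c_j, for degree reasons. *)
Record lfd_frame h d (b : 'I_n -> 'I_n -> cpoly) (c : 'I_n -> C) : Prop := {
  lfd_n : (0 < n)%N;
  lfd_neq0 : h != 0;
  lfd_homog : h \is d.+1.-homog;
  lfd_lin : forall j i, b j i \is 1.-homog;
  lfd_mult : forall j, lie (b j) h = c j *: h;
  lfd_span : forall chi, derlog h chi ->
    exists a : 'I_n -> cpoly, forall i, chi i = \sum_j a j * b j i
}.

Lemma lie_span (a : 'I_n -> cpoly) (b : 'I_n -> 'I_n -> cpoly) chi p :
  (forall i, chi i = \sum_j a j * b j i) ->
  lie chi p = \sum_j a j * lie (b j) p.
Proof.
move=> chiE; transitivity (lie (fun i => \sum_j a j * b j i) p).
  by apply: eq_bigr => i _; rewrite chiE.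
by rewrite (lie_suml _ _ (fun j i => a j * b j i)); apply: eq_bigr => j _;
  rewrite lieMl.
Qed.

Lemma linear_msize (p : cpoly) : p \is 1.-homog -> (msize p <= 2)%N.
Proof.
by move=> /dhomogP H; rewrite msizeE; apply/bigmax_leqP_seq => m /H /= ->.
Qed.

Lemma msize_deriv p i : (msize p^`M(i) <= (msize p).-1)%N.
Proof.
rewrite msizeE; apply/bigmax_leqP_seq => m; rewrite mcoeff_msupp mcoeff_deriv.
move=> pm _; have : (m + U_(i))%MM \in msupp p.
  by rewrite mcoeff_msupp; apply: contraNneq pm => ->; rewrite mul0rn.
move/msize_mdeg_lt; rewrite mdegD mdeg1 addn1.
by case: (msize p).
Qed.

(** Differentiation lowers the degree and a linear coefficient restores it; hence the quotient of
    [lie (b j) h] by h can only be constant. *)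
Lemma msize_lie_le (b : 'I_n -> cpoly) p :
  (forall i, b i \is 1.-homog) -> (msize (lie b p) <= msize p)%N.
Proof.
move=> bH; apply: (leq_trans (msize_sum _ _ _)); apply/bigmax_leqP => i _.
have [->|p0] := eqVneq p^`M(i) 0; first by rewrite mulr0 msize0.
have [->|b0] := eqVneq (b i) 0; first by rewrite mul0r msize0.
rewrite msizeM //; have := linear_msize (bH i); have := msize_deriv p i.
case: (msize p) (msize_poly_eq0 p) => [|s _] /=.
  rewrite eqxx => /esym/eqP pE; by rewrite pE mderiv0 eqxx in p0.
move=> ps2 bs2; apply: (@leq_trans (2 + s).-1) => //.
by rewrite -!subn1 leq_sub2r // leq_add.
Qed.

(** Equality of logarithmic derivatives without division: u/w = z/y and v/y = z/y give u/w = v/y. It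
    is applied with [y] equal to h and [w] a component of h. *)
Lemma cross_mul (T : comRingType) (x u v w y z : T) :
  y * u = z * w -> y * v = z * y -> y * (x * u) * y = w * (x * v) * y.
Proof.
move=> e1 e2; transitivity (x * (y * u) * y); first by ring.
by rewrite e1; transitivity (x * w * (z * y)); [ring|rewrite -e2; ring].
Qed.

(** Each component of h is an eigenfunction of the b_j with the same eigenvalues c_j as h, hence has
    the same logarithmic derivatives. A nonzero component of degree k thus transfers Euler's
    identity to h. *)
Lemma lfd_frame_exists h : linear_free_divisor h ->
  exists d b c, lfd_frame h d b c.
Proof.
case=> hsz _ [b [bH bD bS]].
have h0 : h != 0 by apply: contraTneq hsz => ->; rewrite msize0.
have n0 : (0 < n)%N.
  rewrite lt0n; apply: contraTneq hsz => n0; rewrite -leqNgt msizeE.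
  apply/bigmax_leqP_seq => m _ _; rewrite mdegE big1 // => i.
  by move: (ltn_ord i); rewrite {2}n0.
have span chi : derlog h chi ->
    exists a : 'I_n -> cpoly, forall i, chi i = \sum_j a j * b j i.
  by move/bS=> [a [aE _]]; exists a.
have cE j : exists c : C, lie (b j) h = c *: h.
  have [q qE] := bD j; exists q@_0; rewrite qE -mul_mpolyC; congr (_ * h).
  apply: msize1_polyC; have [->|q0] := eqVneq q 0; first by rewrite msize0.
  have := msize_lie_le h (bH j); rewrite qE msizeM //.
  case: (msize q) => // s; rewrite addSn /= -[X in (_ <= X)%N]add0n.
  by rewrite leq_add2r.
have [c bh] := choice cE.
(* The field h d_i is logarithmic; its coefficients in the basis b_j serve all common eigenfunctions
   q at once. *)
have hd i : exists a : 'I_n -> cpoly,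
    forall q, (forall j, lie (b j) q = c j *: q) ->
      h * q^`M(i) = (\sum_j c j *: a j) * q.
  have [|a aE] := span (fun k => if k == i then h else 0).
    by exists (h^`M(i)); rewrite lie_delta mulrC.
  exists a => q qE; rewrite -lie_delta (lie_span _ aE) mulr_suml.
  by apply: eq_bigr => j _; rewrite qE -scalerAr -scalerAl.
have key k : h * \sum_i 'X_i * (hcomp k (ps h))^`M(i) =
    hcomp k (ps h) * \sum_i 'X_i * h^`M(i).
  rewrite !mulr_sumr; apply: eq_bigr => i _; have [a aE] := hd i.
  apply: (mulIf h0).
  have e1 : h * (hcomp k (ps h))^`M(i) = (\sum_j c j *: a j) * hcomp k (ps h).
    apply: aE => j; rewrite lie_hcomp // bh psZ; apply/mpolyP => m.
    by rewrite mcoeffZ !mcoeff_hcomp; case: eqP; rewrite ?mulr0.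
  exact: cross_mul e1 (aE _ bh).
have [k hk] : exists k, hcomp k (ps h) != 0.
  apply: contrapT => /forallNP H; move/eqP: h0; apply.
  rewrite (sum_hcomp h) big1 // => i _; apply/eqP; apply/negPn/negP.
  exact: H.
have hH : h \is k.-homog.
  apply: euler_homog; have := key k; rewrite (euler (hcomp_homog k _)).
  by move=> K; apply: (mulfI hk); rewrite -K -!scalerAr mulrC.
case: k hH {hk} => [/dhomogP hH|d hH].
  exfalso; move: hsz; rewrite ltnNge => /negP; apply.
  by rewrite msizeE; apply/bigmax_leqP_seq => m /hH /= ->.
by exists d, b, c; split.
Qed.

End Jacobian.

(** * The line on which df(Der(-log h)) vanishes *)

Section CriticalLine.
Context {R : realType} {n : nat}.
Local Notation C := (complex R).
Local Notation cpoly := {mpoly C[n]}.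
Local Notation ps := (@ps_of_mpoly R n).
Implicit Types (p q h f l : cpoly) (chi : 'I_n -> cpoly) (t : C).

(* The linear forms b_j(f) - c_j/(d+1) f generate df(Der(-log h)), because the
   Euler field multiplies h by d + 1. *)
Definition crit_form d (b : 'I_n -> 'I_n -> cpoly) (c : 'I_n -> C) f j : cpoly :=
  lie (b j) f - (c j / d.+1%:R) *: f.

(** Row j lists the coefficients of the j-th linear form, so critical points are the solutions of A
    v = 0. *)
Definition crit_mx d b c f : 'M[C]_n :=
  \matrix_(j, i) ((@crit_form d b c f j)^`M(i))@_0.

Definition crit_point h f (v : 'I_n -> C) : Prop :=
  forall chi, lie chi h = 0 -> (lie chi f).@[v] = 0.

Lemma natC_neq0 d : (d.+1%:R : C) != 0.
Proof. by rewrite pnatr_eq0. Qed.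

Lemma lieX d p : p \is d.-homog -> lie (fun i => 'X_i) p = d%:R *: p.
Proof. exact: euler. Qed.

Lemma X_homog i : ('X_i : cpoly) \is 1.-homog.
Proof. by rewrite dhomogX /= mdeg1. Qed.

Lemma hcomp0_ps p : hcomp 0 (ps p) = (p@_0)%:MP.
Proof.
apply/mpolyP => m; rewrite mcoeff_hcomp mcoeffC mdeg_eq0 eq_sym.
by case: eqP => [<-|]; rewrite ?mulr1 ?mulr0.
Qed.

Lemma deriv_sum0 i I (r : seq I) (F : I -> cpoly) :
  ((\sum_(j <- r) F j)^`M(i))@_0 = \sum_(j <- r) ((F j)^`M(i))@_0.
Proof. by rewrite (raddf_sum (mderiv i)) (raddf_sum (mcoeff 0)). Qed.

Section Frame.
Context h f d b c (B : @lfd_frame R n h d b c) (fH : f \is 1.-homog).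
Local Notation L := (crit_form d b c f).
Local Notation A := (crit_mx d b c f).

Lemma crit_form_homog j : L j \is 1.-homog.
Proof.
rewrite rpredB ?rpredZ //; rewrite -[1%N]addn0.
exact: (lie_homog (lfd_lin B j) fH).
Qed.

Lemma crit_form_lie j : exists2 chi, lie chi h = 0 & lie chi f = L j.
Proof.
exists (fun i => b j i + (- (c j / d.+1%:R))%:MP * 'X_i).
  rewrite lieDl lieMl (lfd_mult B) (lieX (lfd_homog B)) mul_mpolyC scalerA.
  by rewrite mulNr divfK ?natC_neq0 // scaleNr subrr.
by rewrite lieDl lieMl (lieX fH) scale1r mul_mpolyC scaleNr.
Qed.

(** For chi = sum a_j b_j, chi(h) = 0 means sum a_j c_j = 0, so the corrections by multiples of f
    cancel. *)
Lemma lie_crit_form chi : lie chi h = 0 ->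
  exists a : 'I_n -> cpoly, lie chi f = \sum_j a j * L j.
Proof.
move=> chih; have [|a aE] := lfd_span B (chi := chi).
  by rewrite /derlog chih; exact: mdvd0.
exists a; rewrite (lie_span _ aE).
have /(mulIf (lfd_neq0 B)) E : (\sum_j c j *: a j) * h = 0 * h.
  rewrite mul0r -[RHS]chih (lie_span _ aE) mulr_suml; apply: eq_bigr => j _.
  by rewrite (lfd_mult B) -scalerAl -scalerAr.
rewrite /crit_form; under [RHS]eq_bigr => j _ do rewrite mulrBr.
rewrite sumrB; set s := (X in _ = _ - X); suff -> : s = 0 by rewrite subr0.
transitivity (d.+1%:R^-1 *: ((\sum_j c j *: a j) * f)).
  rewrite mulr_suml scaler_sumr; apply: eq_bigr => j _.
  by rewrite -scalerAl scalerA -scalerAr mulrC.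
by rewrite E mul0r scaler0.
Qed.

Lemma meval_crit_form v j : (L j).@[v] = \sum_i v i * A j i.
Proof.
rewrite (meval_linear v (crit_form_homog j)).
by apply: eq_bigr => i _; rewrite mxE.
Qed.

Lemma crit_pointP v : crit_point h f v <-> forall j, (L j).@[v] = 0.
Proof.
split=> [H j|H chi /lie_crit_form[a ->]].
  by have [chi chih <-] := crit_form_lie j; exact: H.
by rewrite raddf_sum big1 //= => j _; rewrite mevalM H mulr0.
Qed.

(** The Euler field is a constant combination sum e_j b_j with sum e_j c_j = d + 1; hence sum e_j
    L_j = f - f = 0 is a linear relation between the rows. *)
Lemma det_crit_mx : \det A = 0.
Proof.
have [|a aE] := lfd_span B (chi := fun i => 'X_i).
  by exists d.+1%:R%:MP; rewrite (lieX (lfd_homog B)) mul_mpolyC.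
pose e j := (a j)@_0.
have eE i : 'X_i = \sum_j (e j)%:MP * b j i.
  have := congr1 (fun p => hcomp 1 (ps p)) (aE i).
  rewrite (hcomp_ps_homog _ (X_homog i)) eqxx => ->.
  rewrite ps_sum hcomp_sum; apply: eq_bigr => j _.
  by rewrite -psM (hcomp_psmul _ _ (lfd_lin B j i)) subnn hcomp0_ps.
have ec : \sum_j e j * c j = d.+1%:R.
  have /eqP := lie_span h eE; rewrite (lieX (lfd_homog B)).
  under eq_bigr => j _ do rewrite (lfd_mult B) mul_mpolyC scalerA.
  rewrite -scaler_suml -subr_eq0 -scalerBl scaler_eq0 (negbTE (lfd_neq0 B)) orbF.
  by rewrite subr_eq0 => /eqP.
have eL : \sum_j (e j)%:MP * L j = 0.
  rewrite /crit_form; under eq_bigr => j _ do rewrite mulrBr.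
  rewrite sumrB -(lie_span f eE) (lieX fH) scale1r.
  under eq_bigr => j _ do rewrite mul_mpolyC scalerA mulrA.
  by rewrite -scaler_suml -mulr_suml ec divff ?natC_neq0 // scale1r subrr.
apply/eqP/det0P; exists (\row_j e j).
  have i0 := Ordinal (lfd_n B); apply: contraT => /negPn/eqP e0.
  have := eE i0; rewrite big1 => [/(congr1 (fun p => p@_U_(i0)))/eqP|j _].
    by rewrite mcoeffX eqxx mcoeff0 oner_eq0.
  have /rowP/(_ j) := e0; rewrite !mxE => ->; by rewrite mpolyC0 mul0r.
apply/rowP => i; rewrite !mxE.
have := congr1 (fun p => (p^`M(i))@_0) eL; rewrite /= mderiv0 mcoeff0 => E.
rewrite -[RHS]E deriv_sum0; apply: eq_bigr => j _.
by rewrite !mxE mul_mpolyC mderivZ mcoeffZ.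
Qed.

Lemma exists_crit_point : exists2 v, crit_point h f v & exists i, v i != 0.
Proof.
have /eqP/det0P[v v0 vA] : \det A^T = 0 by rewrite det_tr det_crit_mx.
exists (v 0).
  apply/crit_pointP => j; rewrite meval_crit_form.
  have /rowP/(_ j) := vA; rewrite !mxE => E; rewrite -[RHS]E.
  by apply: eq_bigr => i _; rewrite !mxE.
apply: contrapT => /forallNP H; move/eqP: v0; apply; apply/rowP => i.
by rewrite mxE; apply/eqP/negPn/negP; exact: H.
Qed.

(** By duality, a linear form vanishing on the kernel of A lies in the row space of A, whose rows
    are values chi(f) with chi(h) = 0. *)
Lemma crit_span v p : crit_point h f v ->
  (forall u, crit_point h f u -> exists a, forall i, u i = a * v i) ->
  p \is 1.-homog -> p.@[v] = 0 -> exists2 chi, lie chi h = 0 & lie chi f = p.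
Proof.
move=> vW line pH pv; pose r : 'rV[C]_n := \row_i (p^`M(i))@_0.
have rA : (r <= A)%MS.
  apply/submxP; suff /submxP : (r <= A)%MS by [].
  rewrite submxE; apply/eqP/rowP => k; rewrite !mxE.
  (* Each column of the cokernel is annihilated by A, so it is a critical point and a multiple of
     v. *)
  pose u i := cokermx A i k.
  have [|a uE] := line u.
    apply/crit_pointP => j; rewrite meval_crit_form.
    have /matrixP/(_ j k) := mulmx_coker A; rewrite !mxE => E; rewrite -[RHS]E.
    by apply: eq_bigr => i _; rewrite mulrC.
  rewrite (eq_bigr (fun i => a * (v i * (p^`M(i))@_0))); last first.
    by move=> i _; rewrite mxE -/(u i) uE; ring.
  by rewrite -mulr_sumr -(meval_linear v pH) pv mulr0.
have [D rE] := submxP rA.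
have [X XP] := choice (fun j => (let: ex_intro2 chi a b := crit_form_lie j in
  ex_intro (fun chi => lie chi h = 0 /\ lie chi f = L j) chi (conj a b))).
exists (fun i => \sum_j (D 0 j)%:MP * X j i).
  rewrite (lie_suml _ _ (fun j i => (D 0 j)%:MP * X j i)) big1 // => j _.
  by rewrite lieMl (XP j).1 mulr0.
rewrite (lie_suml _ _ (fun j i => (D 0 j)%:MP * X j i)).
have eq_lin (p1 p2 : cpoly) : p1 \is 1.-homog -> p2 \is 1.-homog ->
    (forall i, (p1^`M(i))@_0 = (p2^`M(i))@_0) -> p1 = p2.
  move=> H1 H2 E; rewrite -[p1]scale1r -[p2]scale1r -(euler H1) -(euler H2).
  apply: eq_bigr => i _; congr (_ * _); have := E i.
  have [c1 ->] := lin_deriv i H1; have [c2 ->] := lin_deriv i H2.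
  by rewrite !mcoeffC eqxx !mulr1 => ->.
apply: eq_lin => [|//|i].
  apply: rpred_sum => j _; rewrite lieMl mul_mpolyC rpredZ // (XP j).2.
  exact: crit_form_homog.
have /rowP/(_ i) := rE; rewrite !mxE => ->; rewrite deriv_sum0.
apply: eq_bigr => j _.
by rewrite lieMl mul_mpolyC mderivZ mcoeffZ (XP j).2 mxE.
Qed.

End Frame.

Lemma meval_homog d p (v : 'I_n -> C) (a : C) : p \is d.-homog ->
  p.@[fun i => a * v i] = a ^+ d * p.@[v].
Proof.
move=> /dhomogP pH; rewrite !mevalE mulr_sumr !big_seq; apply: eq_bigr => m ms.
rewrite mulrCA; congr (_ * _).
under eq_bigr => i _ do rewrite exprMn.
rewrite big_split /= prodrXr; congr (_ ^+ _ * _).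
by rewrite -mdegE; exact: pH.
Qed.

Lemma poly_line p (u v : 'I_n -> C) :
  exists P : {poly C}, forall x, P.[x] = p.@[fun i => u i + x * v i].
Proof.
exists (\sum_(m <- msupp p)
   (p@_m)%:P * \prod_i ((u i)%:P + v i *: 'X) ^+ m i) => x.
rewrite horner_sum mevalE; apply: eq_bigr => m _.
rewrite hornerM hornerC; congr (_ * _); rewrite horner_prod.
by apply: eq_bigr => i _; rewrite horner_exp !hornerE mulrC.
Qed.

Lemma poly_root_or_const (P : {poly C}) :
  (exists x, P.[x] = 0) \/ (forall x, P.[x] = P.[0]).
Proof.
have [/eqP sP|/closed_rootP[x /rootP Px]] := eqVneq (size P) 1%N.
  by right=> x; move/eqP/eq_leq/size1_polyC: sP => ->; rewrite !hornerC.
by left; exists x.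
Qed.

(* Over an algebraically closed field a homogeneous form of positive degree has
   a zero on every plane. *)
Lemma proportional_of_no_zero d h (u v : 'I_n -> C) :
  h \is d.+1.-homog -> (exists i, v i != 0) -> (exists i, u i != 0) ->
  (forall x y, (exists i, x * u i + y * v i != 0) ->
     h.@[fun i => x * u i + y * v i] != 0) ->
  exists a, forall i, u i = a * v i.
Proof.
move=> hH [iv vi] [iu ui] nz.
have zero x y w : w =1 (fun i => x * u i + y * v i) -> h.@[w] = 0 -> w =1 fun=> 0.
  move=> wE; rewrite (meval_eq _ wE) => /eqP E i; rewrite wE.
  by apply/eqP; apply: contraTT E => H; apply: nz; exists i.
have [P PE] := poly_line h u v; have [Q QE] := poly_line h v u.
(* A root gives h(u + x v) = 0, which by hypothesis forces u = - x v. *)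
have [[x]|Pc] := poly_root_or_const P.
  rewrite PE => /(zero 1 x) H; exists (- x) => i; apply/eqP.
  by rewrite mulNr -addr_eq0 H // => j; rewrite mul1r.
have [[x]|Qc] := poly_root_or_const Q.
  rewrite QE => /(zero x 1) E.
  have {}E i : v i + x * u i = 0 by rewrite E // => j; rewrite mul1r addrC.
  have x0 : x != 0.
    by apply: contraNneq vi => x0; have := E iv; rewrite x0 mul0r addr0 => ->.
  exists (- x^-1) => i; have /eqP := E i; rewrite addr_eq0 => /eqP ->.
  by rewrite mulrNN mulKf.
exfalso.
have hu : h.@[u] != 0.
  have uE : u =1 (fun i => 1 * u i + 0 * v i).
    by move=> i; rewrite mul1r mul0r addr0.
  by rewrite (meval_eq _ uE) nz //; exists iu; rewrite -uE.
have Pu : P.[0] = h.@[u].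
  by rewrite PE; apply: meval_eq => i; rewrite mul0r addr0.
(* Both restrictions are now constant, and they agree at u + v. Comparing u + 2v = 2 (v + u/2) then
   gives h(u) = 2^(d+1) h(u) with h(u) nonzero. *)
have PQ1 : P.[1] = Q.[1].
  by rewrite PE QE; apply: meval_eq => i; rewrite !mul1r addrC.
have PQ2 : P.[2] = 2 ^+ d.+1 * Q.[2^-1].
  rewrite PE QE -(meval_homog _ _ hH); apply: meval_eq => i.
  by rewrite mulrDr mulrA divff ?mul1r ?pnatr_eq0 // addrC.
move: PQ2; rewrite Pc (Qc 2^-1) -(Qc 1) -PQ1 Pc Pu => /eqP.
rewrite -{1}[h.@[u]]mul1r (inj_eq (mulIf hu)) => /eqP E.
have : (1 : C) < 2 ^+ d.+1 by rewrite exprn_egt1 // ltr1n.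
by rewrite -E ltxx.
Qed.

End CriticalLine.

(** * Reduction modulo the ideal to powers of one linear form *)

Section Reduction.
Context {R : realType} {n : nat}.
Local Notation C := (complex R).
Local Notation cpoly := {mpoly C[n]}.
Local Notation ps := (@ps_of_mpoly R n).
Implicit Types (p q h f l : cpoly) (chi : 'I_n -> cpoly) (t : C).

Lemma lin_expr_homog l k : l \is 1.-homog -> (l ^+ k : cpoly) \is k.-homog.
Proof. by move=> /(dhomogMn k); rewrite mul1n. Qed.

(** The powers l^k, k < N, are independent in T^1: a relation splits by degree, and at v the terms
    chi(f) vanish, while the multiple of h vanishes because h(v) = 0 or because k <= d. *)
Lemma power_bound d h f g l v N :
  h \is d.+1.-homog -> f \is 1.-homog -> T1_basis h f g ->
  crit_point h f v -> l \is 1.-homog -> l.@[v] != 0 ->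
  h.@[v] = 0 \/ (N <= d.+1)%N -> (N <= n)%N.
Proof.
move=> hH fH [gspan _] vW lH lv hv; rewrite leqNgt; apply/negP => nN.
have [M ME] := choice (fun k : 'I_N => gspan _ (ps_convergent (l ^+ k))).
have [c c0 cM] := exists_left_kernel (\matrix_(k, i) M k i) nN.
pose p : cpoly := \sum_k c 0 k *: l ^+ k.
have pT : T1_zero h f (ps p).
  apply/(T1_zero_jac _ hH fH).
  have -> : p = \sum_k c 0 k *: (l ^+ k - \sum_i M k i *: g i).
    under eq_bigr => k _ do rewrite scalerBr.
    rewrite sumrB -[LHS]subr0; congr (_ - _); apply/esym.
    under eq_bigr => k _ do rewrite scaler_sumr.
    rewrite exchange_big big1 // => i _ /=.
    under eq_bigr => k _ do rewrite scalerA.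
    rewrite -scaler_suml; have /rowP/(_ i) := cM; rewrite !mxE => E.
    rewrite (_ : \sum_i0 _ = 0) ?scale0r // -[RHS]E.
    by apply: eq_bigr => k _; rewrite mxE.
  apply: jac_sum => k _; apply: jacZ; apply/(T1_zero_jac _ hH fH).
  rewrite psB ps_sum; under eq_bigr => i _ do rewrite psZ.
  exact: ME.
move/eqP: c0; apply; apply/rowP => k; rewrite mxE.
have [chi [q [chih]]] := T1_zero_hcomp k hH fH pT.
rewrite ps_sum hcomp_sum (bigD1 k) //=.
rewrite (hcomp_ps_homog _ (rpredZ _ (lin_expr_homog k lH))) eqxx.
rewrite big1 ?addr0 => [|j jk]; last first.
  rewrite (hcomp_ps_homog _ (rpredZ _ (lin_expr_homog j lH))).
  by rewrite ifN // eq_sym.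
move/(congr1 (meval v)); rewrite mevalD (vW _ chih) add0r mevalZ rmorphXn.
have -> : (if (d < k)%N then q * h else 0).@[v] = 0.
  case: ltnP => dk; rewrite ?meval0 // mevalM.
  case: hv => [->|Nd]; first by rewrite mulr0.
  by move: (leq_trans (ltn_ord k) Nd); rewrite ltnS leqNgt dk.
by move/eqP; rewrite mulf_eq0 expf_eq0 (negbTE lv) andbF orbF => /eqP.
Qed.

(** With fewer than n generators, the coordinate rows of the g_i would be dependent, against
    freeness of g in T^1. *)
Lemma span_bound d h f g (N : nat) (w : 'I_N -> cpoly) :
  h \is d.+1.-homog -> f \is 1.-homog -> T1_basis h f g ->
  (forall p, exists a : 'I_N -> C, jac h f 0 (p - \sum_k a k *: w k)) ->
  (n <= N)%N.
Proof.
move=> hH fH [_ gfree] wspan; rewrite leqNgt; apply/negP => nN.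
have [M ME] := choice (fun i => wspan (g i)).
have [c c0 cM] := exists_left_kernel (\matrix_(i, k) M i k) nN.
move/eqP: c0; apply; apply/rowP => i; rewrite mxE; move: i; apply: gfree.
rewrite -(eq_bigr _ (fun i _ => psZ _ _)) -ps_sum; apply/(T1_zero_jac _ hH fH).
have -> : \sum_i c 0 i *: g i =
    \sum_i c 0 i *: (g i - \sum_k M i k *: w k).
  under [RHS]eq_bigr => k _ do rewrite scalerBr.
  rewrite sumrB -[LHS]subr0; congr (_ - _); apply/esym.
  under eq_bigr => k _ do rewrite scaler_sumr.
  rewrite exchange_big big1 // => k _ /=.
  under eq_bigr => i _ do rewrite scalerA.
  rewrite -scaler_suml; have /rowP/(_ k) := cM; rewrite !mxE => E.
  rewrite (_ : \sum_i _ = 0) ?scale0r // -[RHS]E.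
  by apply: eq_bigr => i _; rewrite mxE.
by apply: jac_sum => i _; apply: jacZ; exact: ME.
Qed.

Section Line.
Context (h f l : cpoly) (d : nat) (v : 'I_n -> C).
Context (hH : h \is d.+1.-homog) (hv : h.@[v] != 0).
Context (lin_red : forall p, p \is 1.-homog ->
  exists2 chi, lie chi h = 0 & lie chi f = p - p.@[v] *: l).

(** For a form of degree k, the ideal leaves only its value at v, with l^k as normal form. *)
Let red t k p := jac h f t (p - p.@[v] *: l ^+ k).

Lemma redM t k k' p q : red t k p -> red t k' q -> red t (k + k') (p * q).
Proof.
move=> rp rq; rewrite /red.
have -> : p * q - (p * q).@[v] *: l ^+ (k + k') =
    q * (p - p.@[v] *: l ^+ k) + p.@[v] *: (l ^+ k * (q - q.@[v] *: l ^+ k')).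
  by rewrite mevalM exprD -!mul_mpolyC mpolyCM; ring.
by apply: jacD; [exact: jacM|apply: jacZ; exact: jacM].
Qed.

Lemma redX t m : red t (mdeg m) 'X_[m].
Proof.
have r1 : red t 0 1 by rewrite /red meval1 expr0 scale1r subrr; exact: jac0.
rewrite mdegE mpolyXE_id.
apply: (big_ind2 (fun p k => red t k p)) => [//||i _].
- by move=> p k q k'; exact: redM.
elim: (m i) => [//|k IH]; rewrite exprS -add1n; apply: redM => //.
have [chi chih chif] := lin_red (X_homog i).
by rewrite /red expr1 -chif; exact: jac_lie.
Qed.

Lemma red_homog t k p : p \is k.-homog -> red t k p.
Proof.
move=> /dhomogP pH; rewrite /red mevalE.
rewrite {1}(mpolyE p) scaler_suml -sumrB big_seq; apply: jac_sum => m ms.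
by have := redX t m; rewrite /red (pH _ ms) -scalerA -scalerBr mevalX => /jacZ.
Qed.

Lemma span_powers t p : exists a : 'I_d.+1 -> C,
  jac h f t (p - \sum_k a k *: l ^+ k).
Proof.
pose spanned p := exists a : 'I_d.+1 -> C, jac h f t (p - \sum_k a k *: l ^+ k).
have spanD p1 p2 : spanned p1 -> spanned p2 -> spanned (p1 + p2).
  move=> [a1 H1] [a2 H2]; exists (fun k => a1 k + a2 k).
  under eq_bigr => k _ do rewrite scalerDl.
  by rewrite big_split opprD addrACA; exact: jacD.
have spanZ (c : C) p1 : spanned p1 -> spanned (c *: p1).
  move=> [a H]; exists (fun k => c * a k).
  under eq_bigr => k _ do rewrite -scalerA.
  by rewrite -scaler_sumr -scalerBr; exact: jacZ.
have spanJ p1 : jac h f t p1 -> spanned p1.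
  by exists (fun=> 0); rewrite big1 ?subr0 // => k _; rewrite scale0r.
have spanX j : spanned (l ^+ j).
  have [m] := ubnP j; elim: m j => // m IH j; rewrite ltnS => jm.
  have [jd|dj] := ltnP j d.+1.
    exists (fun k : 'I_d.+1 => if k == Ordinal jd then 1 else 0).
    rewrite (bigD1 (Ordinal jd)) //= eqxx scale1r big1 ?addr0 ?subrr => [|k].
      exact: jac0.
    by move/negbTE ->; rewrite scale0r.
  (* Modulo the ideal h equals both t and h(v) l^(d+1), so l^(d+1) may be replaced by the constant
     [a]. *)
  pose a := t / h.@[v].
  rewrite -[l ^+ j](subrK (a *: l ^+ (j - d.+1))); apply: (spanD); last first.
    by apply/spanZ/IH; apply: leq_trans jm; rewrite ltn_subrL (leq_trans _ dj).
  apply: spanJ.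
  have -> : l ^+ j - a *: l ^+ (j - d.+1) = l ^+ (j - d.+1) * (h.@[v]^-1 *:
      (1 * (h - t%:MP) - (h - h.@[v] *: l ^+ d.+1))).
    have -> : 1 * (h - t%:MP) - (h - h.@[v] *: l ^+ d.+1) =
        h.@[v] *: l ^+ d.+1 - t%:MP by rewrite -mul_mpolyC; ring.
    rewrite scalerBr scalerA mulVf // scale1r.
    rewrite mulrBr -exprD subnK //; congr (_ - _).
    by rewrite -[_^-1 *: _]mul_mpolyC -mpolyCM [RHS]mulrC mul_mpolyC /a [t / _]mulrC.
  by apply: jacM; apply: jacZ; apply: jacB; [exact: jac_h|exact: red_homog].
rewrite -/(spanned p) (sum_hcomp p).
apply: big_ind => [||k _]; first exact/spanJ/jac0.
  exact: spanD.
set q := hcomp _ _; rewrite -[q](subrK (q.@[v] *: l ^+ k)); apply: spanD.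
  by apply: spanJ; apply: red_homog; exact: hcomp_homog.
exact/spanZ/spanX.
Qed.

End Line.

(** Once the critical locus is known to be a line off D, the powers 1, ..., l^d are both independent
    in T^1 and spanning, which forces d + 1 = n. *)
Theorem jacobian_structure h f g :
  linear_free_divisor h -> f \is 1.-homog -> T1_basis h f g ->
  exists l, [/\ (0 < n)%N, h \is n.-homog, l \is 1.-homog, l = f \/ n = 1%N
    & forall t p, exists a : 'I_n -> C, jac h f t (p - \sum_k a k *: l ^+ k)].
Proof.
move=> /lfd_frame_exists[d [b [c B]]] fH hg; have hH := lfd_homog B.
have [v0 v0W [i0 v0i]] := exists_crit_point B fH.
have Wlin u w x y : crit_point h f u -> crit_point h f w ->
    crit_point h f (fun i => x * u i + y * w i).
  rewrite !(crit_pointP B fH) => uW wW j; rewrite (meval_crit_form B fH).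
  under eq_bigr => i _ do rewrite mulrDl -!mulrA.
  by rewrite big_split /= -!mulr_sumr -!(meval_crit_form B fH) uW wW !mulr0 addr0.
(* At a nonzero critical point on D, n + 1 powers of a coordinate would be independent in T^1. *)
have hW u : crit_point h f u -> (exists i, u i != 0) -> h.@[u] != 0.
  move=> uW [i ui]; apply/eqP => hu.
  have := @power_bound d h f g 'X_i u n.+1 hH fH hg uW (X_homog i).
  by rewrite mevalXU ltnn => /(_ ui (or_introl hu)).
have line v u : crit_point h f v -> (exists i, v i != 0) -> crit_point h f u ->
    exists a, forall i, u i = a * v i.
  move=> vW vn uW; have [un|/forallNP u0] := pselect (exists i, u i != 0).
    apply: (proportional_of_no_zero hH) => // x y xy; exact: hW (Wlin _ _ _ _ _ _) xy.
  by exists 0 => i; rewrite mul0r; apply/eqP/negPn/negP; exact: u0.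
have [l lH [lv0 lf]] : exists2 l, l \is 1.-homog & l.@[v0] != 0 /\ (l = f \/ n = 1%N).
  have [fv|fv] := eqVneq f.@[v0] 0; last by exists f => //; split=> //; left.
  exists 'X_i0; first exact: X_homog.
  split; first by rewrite mevalXU.
  right; apply: contrapT => /eqP n1.
  (* Expanding the logarithmic field h d_i in the b_j and evaluating at v0, where every b_j(f)
     vanishes, kills h(v0) times the coefficient of f. *)
  have f0 : f = 0.
    rewrite -[f]scale1r -(euler fH) big1 // => i _.
    have [|a aE] := lfd_span B (chi := fun k => if k == i then h else 0).
      by exists (h^`M(i)); rewrite lie_delta mulrC.
    have [e fe] := lin_deriv i fH.
    have := congr1 (meval v0) (lie_span f aE); rewrite lie_delta fe mevalM mevalC.
    rewrite raddf_sum big1 => [/eqP|j _] /=.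
      rewrite mulf_eq0 (negbTE (hW _ v0W _)); last by exists i0.
      by move=> /eqP ->; rewrite mpolyC0 mulr0.
    have := (crit_pointP B fH v0).1 v0W j; rewrite mevalB mevalZ fv mulr0 subr0.
    by rewrite mevalM => ->; rewrite mulr0.
  (* With f = 0 the critical line is the whole space, which is impossible in dimension at least
     two. *)
  have allW u : crit_point h f u.
    move=> chi _; rewrite f0 /lie big1 ?meval0 // => i _.
    by rewrite mderiv0 mulr0.
  have [i1 i10] : exists i1, i1 != i0.
    have n2 : (1 < n)%N by rewrite ltn_neqAle eq_sym n1 (lfd_n B).
    have [->|ne] := eqVneq i0 (Ordinal (lfd_n B)); last first.
      by exists (Ordinal (lfd_n B)); rewrite eq_sym.
    by exists (Ordinal n2).
  have [a aE] := line v0 (fun i => (i == i1)%:R) v0W (ex_intro _ i0 v0i) (allW _).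
  have /eqP := aE i0; rewrite [i0 == i1]eq_sym (negbTE i10) eq_sym mulf_eq0 (negbTE v0i).
  rewrite orbF => /eqP a0; have /eqP := aE i1.
  by rewrite eqxx a0 mul0r oner_eq0.
(* Normalized so that l(v) = 1; then p - p(v) l vanishes at v and is of the form chi(f). *)
pose v i := l.@[v0]^-1 * v0 i.
have vE : v =1 (fun i => l.@[v0]^-1 * v0 i + 0 * v0 i).
  by move=> i; rewrite mul0r addr0.
have vW : crit_point h f v.
  by rewrite (funext vE); exact: Wlin.
have lv : l.@[v] = 1 by rewrite (meval_homog _ _ lH) expr1 mulVf.
have vn : exists i, v i != 0 by exists i0; rewrite mulf_neq0 // invr_eq0.
have lin_red p : p \is 1.-homog ->
    exists2 chi, lie chi h = 0 & lie chi f = p - p.@[v] *: l.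
  move=> pH; apply: (crit_span B fH vW) => [u||].
  - exact: line.
  - by rewrite rpredB ?rpredZ.
  by rewrite mevalB mevalZ lv mulr1 subrr.
have span := span_powers hH (hW _ vW vn) lin_red.
have dn : d.+1 = n.
  apply/eqP; rewrite eqn_leq; apply/andP; split.
    by apply: (power_bound hH fH hg vW lH); [rewrite lv oner_neq0|right].
  exact: (span_bound hH fH hg (span 0)).
have hHn : h \is n.-homog by move: (hH); rewrite [X in X.-homog]dn.
exists l; split=> //; first exact: lfd_n B.
move=> t p; have [a aP] := span t p.
exists (fun k => a (cast_ord (esym dn) k)).
rewrite (reindex (cast_ord dn)) /=; last first.
  by exists (cast_ord (esym dn)) => k _; rewrite ?cast_ordK ?cast_ordKV.
by under eq_bigr => k _ do rewrite cast_ordK.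
Qed.

End Reduction.

(** * Logarithmic (n-1)-forms as logarithmic vector fields *)

Section FormsVectorFields.
Context {R : realType} {n : nat}.
Local Notation C := (complex R).
Local Notation cpoly := {mpoly C[n]}.
Local Notation form := (extform R n).
Implicit Types (p q h f : cpoly) (chi : 'I_n -> cpoly) (t : C) (w : form).
Implicit Types (K : {set 'I_n}).

(** Exponent of the sign of dx_i /\ dx_J relative to the volume form, J being the complement of
    i. *)
Definition hodge_sign (i : 'I_n) : nat := inversions [set i]%SET (~: [set i])%SET.

(* The contraction of the volume form by chi. *)
Definition star1 chi : form :=
  [ffun I => \sum_(i | I == (~: [set i])%SET) (-1) ^+ hodge_sign i * chi i].

(* The contraction of the volume form by chi /\ Euler; the sum over ordered
   pairs does the antisymmetrization. *)
Definition star2 chi : form :=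
  [ffun I => \sum_(ij : 'I_n * 'I_n |
       (ij.1 != ij.2) && (I == (~: [set ij.1; ij.2])%SET))
     (-1) ^+ ((ij.1 < ij.2)%N + hodge_sign ij.1 + hodge_sign ij.2)%N *
     (chi ij.2 * 'X_(ij.1))].

Lemma inversions1 (j : 'I_n) K : inversions [set j]%SET K = #|[set x in K | (x < j)%N]|.
Proof.
have inj : injective (fun x : 'I_n => (j, x)) by move=> x y [].
rewrite /inversions -(card_imset _ inj).
apply: eq_card => -[a b]; apply/idP/imsetP => [/set_mem /= /and3P[]|[x]].
  by rewrite finset.in_set1 => /eqP -> bK lt_bj; exists b; rewrite // inE bK.
rewrite inE => /andP[xK xj] [-> ->]; apply/mem_set => /=.
by rewrite finset.in_set1 eqxx xK.
Qed.

(** On the left only k is missing from the complement of j, and [hodge_sign j] counts it exactly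
    when [k < j]. *)
Lemma inversionsD1 (j k : 'I_n) : j != k ->
  (inversions [set j] (~: [set k] :\ j) + (k < j) = hodge_sign j)%N.
Proof.
move=> jk; rewrite /hodge_sign !inversions1.
rewrite [RHS](cardsD1 k) !inE eq_sym jk /= addnC; congr (_ + _)%N.
apply: eq_card => x; rewrite !inE.
by case: (eqVneq x j) => [->|]; rewrite ?ltnn ?andbF ?andbT.
Qed.

Lemma sign2 (k : nat) (p : cpoly) : (-1) ^+ k * ((-1) ^+ k * p) = p.
Proof. by rewrite mulrA -exprMn mulrNN mulr1 expr1n mul1r. Qed.

Lemma mderiv_sign i (k : nat) p : ((-1) ^+ k * p)^`M(i) = (-1) ^+ k * p^`M(i).
Proof.
by rewrite -signr_odd; case: (odd k); rewrite ?expr1 ?expr0 ?mulN1r ?mul1r ?mderivN.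
Qed.

Lemma star1E chi i : star1 chi (~: [set i])%SET = (-1) ^+ hodge_sign i * chi i.
Proof.
rewrite ffunE (bigD1 i) //= big1 ?addr0 // => j /andP[/eqP/finset.setC_inj/finset.set1_inj ->].
by rewrite eqxx.
Qed.

Lemma star1_codegree chi : codegree 1 (star1 chi).
Proof.
move=> I cI; rewrite ffunE big1 // => i /eqP IE; move: cI.
by rewrite IE -[in X in (_ + X)%N](cards1 i) addnC cardsC card_ord eqxx.
Qed.

Lemma codegree1P K : (#|K| + 1 = n)%N -> exists k, K = (~: [set k])%SET.
Proof.
move=> cK; have : #|~: K| == 1%N.
  by rewrite -(eqn_add2l #|K|) cardsC card_ord cK.
by move=> /cards1P[k kE]; exists k; rewrite -kE finset.setCK.
Qed.

Lemma setC1D1 (j k : 'I_n) : (~: [set k] :\ j)%SET = (~: [set j; k])%SET.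
Proof. by apply/setP => x; rewrite !inE negb_or. Qed.

Lemma star2_codegree chi : codegree 2 (star2 chi).
Proof.
move=> I cI; rewrite ffunE big1 // => ij /andP[ne /eqP IE]; move: cI.
rewrite IE; have -> : 2%N = #|[set ij.1; ij.2]| by rewrite cards2 ne.
by rewrite addnC cardsC card_ord eqxx.
Qed.

Lemma star2E chi (j k : 'I_n) : j != k ->
  star2 chi (~: [set k] :\ j)%SET =
  (-1) ^+ inversions [set j]%SET (~: [set k] :\ j)%SET *
  ((-1) ^+ hodge_sign k * (chi j * 'X_k - chi k * 'X_j)).
Proof.
move=> jk; rewrite ffunE setC1D1.
(* Only the two orders of the pair j, k give this index set; their terms form the antisymmetric
   difference. *)
have cond (ij : 'I_n * 'I_n) : (ij.1 != ij.2) &&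
    (~: [set j; k] == ~: [set ij.1; ij.2])%SET = (ij == (j, k)) || (ij == (k, j)).
  case: ij => a b /=; rewrite (inj_eq (@finset.setC_inj _)) !xpair_eqE; apply/idP/idP.
    move=> /andP[ab /eqP E].
    have : (a \in [set j; k]%SET) && (b \in [set j; k]%SET).
      by rewrite E !inE !eqxx orbT.
    rewrite !inE => /andP[/orP[]/eqP aE /orP[]/eqP bE]; move: ab; rewrite aE bE ?eqxx //.
    by rewrite orbT.
  case/orP=> /andP[/eqP -> /eqP ->]; first by rewrite jk eqxx.
  by rewrite eq_sym jk finset.setUC eqxx.
rewrite (eq_bigl _ _ cond) (bigD1 (j, k)) ?eqxx //= (bigD1 (k, j)) /=; last first.
  by rewrite eqxx orbT xpair_eqE eq_sym (negbTE jk).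
rewrite big1 ?addr0 => [|ij]; last first.
  by move=> /andP[/andP[/orP[->|->]]] //; rewrite ?andbF.
rewrite -(inversionsD1 jk) -setC1D1; move: (inversions _ _) => s.
have [lt_jk|lt_kj|/val_inj jk'] := ltngtP j k; last by rewrite jk' eqxx in jk.
  by rewrite !exprD /= ?expr0 ?expr1; ring.
by rewrite !exprD /= ?expr0 ?expr1; ring.
Qed.

Lemma wedge_dfun p w K : wedge (dfun p) w K =
  \sum_(i in K) (-1) ^+ inversions [set i]%SET (K :\ i)%SET * p^`M(i) * w (K :\ i)%SET.
Proof.
rewrite ffunE.
under eq_bigr => I _ do rewrite ffunE mulr_sumr mulr_suml.
rewrite (exchange_big_dep predT) //= [RHS]big_mkcond; apply: eq_bigr => i _.
case: ifP => iK.
  rewrite (big_pred1 [set i]%SET) // => I.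
  rewrite /=; case: eqVneq => [->|_]; last by rewrite andbF.
  by rewrite andbT finset.sub1set iK.
by rewrite big1 // => I /andP[IK /eqP IE]; move: IK; rewrite IE finset.sub1set iK.
Qed.

Lemma in_setC1 (j k : 'I_n) : (j \in ~: [set k])%SET = (j != k).
Proof. by rewrite !inE. Qed.

Lemma eq_codegree1 w w' : codegree 1 w -> codegree 1 w' ->
  (forall k, w (~: [set k])%SET = w' (~: [set k])%SET) -> w = w'.
Proof.
move=> cw cw' E; apply/ffunP => K.
have [cK|cK] := eqVneq (#|K| + 1)%N n; last by rewrite cw ?cw'.
by have [k ->] := codegree1P cK.
Qed.

Lemma codegree_D1 c w K (j : 'I_n) : codegree c.+1 w -> j \in K ->
  (#|K| + c)%N != n -> w (K :\ j)%SET = 0.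
Proof.
move=> cw jK cK; apply: cw; apply: contra cK => /eqP E.
by rewrite (cardsD1 j K) jK add1n addSn -addnS E.
Qed.

Lemma wedge_dfun_codegree c p w : codegree c.+1 w -> codegree c (wedge (dfun p) w).
Proof.
move=> cw K cK; rewrite wedge_dfun big1 // => i iK.
by rewrite (codegree_D1 cw iK cK) mulr0.
Qed.

Lemma dform_codegree c w : codegree c.+1 w -> codegree c (dform w).
Proof.
move=> cw K cK; rewrite ffunE big1 // => i iK.
by rewrite (codegree_D1 cw iK cK) mderiv0 mulr0.
Qed.

Lemma fmul_codegree c p w : codegree c w -> codegree c (fmul p w).
Proof. by move=> cw K cK; rewrite ffunE cw ?mulr0. Qed.

(** Invariantly, this is dp /\ vol = 0 contracted with chi and with the Euler field; the proof
    compares coefficients. *)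
Lemma wedge_star2 p chi : wedge (dfun p) (star2 chi) =
  star1 (fun k => lie chi p * 'X_k - lie (fun i => 'X_i) p * chi k).
Proof.
apply: eq_codegree1 => [||k].
- exact/wedge_dfun_codegree/star2_codegree.
- exact: star1_codegree.
rewrite wedge_dfun star1E /lie !mulr_suml -sumrB mulr_sumr [LHS]big_mkcond /=.
apply: eq_bigr => j _; rewrite in_setC1; case: eqVneq => [->|jk] /=.
  by rewrite -[LHS](mulr0 ((-1) ^+ hodge_sign k)); congr (_ * _); ring.
by rewrite (star2E _ jk) -mulrA [p^`M(j) * _]mulrCA sign2; ring.
Qed.

(** The right-hand side is the contraction by the divergence of the bivector chi /\ E. *)
Lemma dform_star2 chi : dform (star2 chi) =
  star1 (fun k => \sum_j (chi j * 'X_k - chi k * 'X_j)^`M(j)).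
Proof.
apply: eq_codegree1 => [||k].
- exact/dform_codegree/star2_codegree.
- exact: star1_codegree.
rewrite ffunE star1E mulr_sumr [LHS]big_mkcond /=.
apply: eq_bigr => j _; rewrite in_setC1; case: eqVneq => [->|jk] /=.
  by rewrite subrr mderiv0 mulr0.
by rewrite (star2E _ jk) !mderiv_sign sign2.
Qed.

Lemma wedge_star1 p chi K :
  wedge (dfun p) (star1 chi) K = if K == [set: 'I_n]%SET then lie chi p else 0.
Proof.
case: eqP => [->|/eqP KT]; last first.
  rewrite (@wedge_dfun_codegree 0) //; first exact: star1_codegree.
  rewrite addn0; apply: contra KT => /eqP KT.
  by rewrite eqEcard finset.subsetT cardsT card_ord KT leqnn.
rewrite wedge_dfun; apply: eq_big => [i|i _]; first by rewrite inE.
have -> : ([set: 'I_n] :\ i = ~: [set i])%SET by apply/setP => x; rewrite !inE andbT.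
by rewrite star1E mulrAC sign2.
Qed.

Lemma log_form_star1 h chi : mdvd h (lie chi h) -> log_form h 1 (star1 chi).
Proof.
move=> D; split; first exact: star1_codegree.
by move=> K; rewrite wedge_star1; case: ifP => // _; exact: mdvd0.
Qed.

Lemma log_form1P h w : log_form h 1 w ->
  exists2 chi, mdvd h (lie chi h) & w = star1 chi.
Proof.
move=> [cw Dw]; pose chi i := (-1) ^+ hodge_sign i * w (~: [set i])%SET.
have wE : w = star1 chi.
  apply: eq_codegree1 => // [|k]; first exact: star1_codegree.
  by rewrite star1E sign2.
by exists chi => //; have := Dw [set: 'I_n]%SET; rewrite {1}wE wedge_star1 eqxx.
Qed.

Lemma star1D chi chi' : star1 chi + star1 chi' = star1 (fun i => chi i + chi' i).
Proof.
apply/ffunP => K; rewrite !ffunE -big_split /=.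
by apply: eq_bigr => i _; rewrite mulrDr.
Qed.

Lemma star1M p chi : fmul p (star1 chi) = star1 (fun i => p * chi i).
Proof.
apply/ffunP => K; rewrite !ffunE mulr_sumr.
by apply: eq_bigr => i _; rewrite mulrCA.
Qed.

Lemma eq_star1 chi chi' : chi =1 chi' -> star1 chi = star1 chi'.
Proof. by move=> /funext ->. Qed.

Lemma star1N chi : - star1 chi = star1 (fun i => - chi i).
Proof.
apply/ffunP => K; rewrite !ffunE -sumrN.
by apply: eq_bigr => i _; rewrite mulrN.
Qed.

(** By [wedge_star2] the product with dh is the contraction by - E(h) chi, and h divides E(h). *)
Lemma log_form_star2 h d chi : h \is d.-homog -> lie chi h = 0 ->
  log_form h 2 (star2 chi).
Proof.
move=> hH chih; split; first exact: star2_codegree.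
move=> K; rewrite wedge_star2 chih (lieX hH) ffunE.
apply: (big_ind (mdvd h)) => [||i _]; [exact: mdvd0|exact: mdvdD|].
rewrite mul0r sub0r -mul_mpolyC; apply: mdvd_mull; apply: mdvdN.
by exists (d%:R%:MP * chi i); ring.
Qed.

Definition euler_form : form := star1 (fun i => 'X_i).

Lemma log_euler_form h d p : h \is d.-homog -> log_form h 1 (fmul p euler_form).
Proof.
move=> hH; rewrite star1M; apply: log_form_star1.
by rewrite lieMl (lieX hH) -mul_mpolyC; exists (p * d%:R%:MP); rewrite mulrA.
Qed.

End FormsVectorFields.

(** * The lattices tau^k G_t *)

Section Lattices.
Context {R : realType} {n : nat}.
Local Notation C := (complex R).
Local Notation cpoly := {mpoly C[n]}.
Local Notation form := (extform R n).
Implicit Types (p q h f l : cpoly) (chi : 'I_n -> cpoly) (t : C) (w : form).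
Implicit Types (a b e z : int -> form).

Lemma lin_add (c : C) (x y x' y' : form) :
  c *: (x + y) + (x' + y') = (c *: x + x') + (c *: y + y').
Proof. by rewrite scalerDr addrACA. Qed.

Lemma lin_opp (c : C) (x x' : form) :
  c *: (- x) + (- x') = - (c *: x + x').
Proof. by rewrite scalerN opprD. Qed.

Lemma formD w w' K : (w + w') K = w K + w' K.
Proof. by rewrite ffunE. Qed.

Lemma formZ (c : C) w K : (c *: w) K = c *: w K.
Proof. by rewrite ffunE. Qed.

Lemma wedge_lin v (c : C) w w' : wedge v (c *: w + w') = c *: wedge v w + wedge v w'.
Proof.
apply/ffunP => K; rewrite !ffunE scaler_sumr -big_split /=; apply: eq_bigr => I _.
by rewrite !ffunE mulrDr -scalerAr.
Qed.

Lemma dform_lin (c : C) w w' : dform (c *: w + w') = c *: dform w + dform w'.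
Proof.
apply/ffunP => K; rewrite !ffunE scaler_sumr -big_split /=; apply: eq_bigr => i _.
by rewrite !ffunE mderivD mderivZ mulrDr -scalerAr.
Qed.

Lemma fmul_lin p (c : C) w w' : fmul p (c *: w + w') = c *: fmul p w + fmul p w'.
Proof. by apply/ffunP => K; rewrite !ffunE mulrDr -scalerAr. Qed.

Lemma fmulr_lin (c : C) p q w : fmul (c *: p + q) w = c *: fmul p w + fmul q w.
Proof. by apply/ffunP => K; rewrite !ffunE mulrDl -scalerAl. Qed.

Lemma wedge0r v : wedge v (0 : form) = 0.
Proof. by have := wedge_lin v (-1) 0 0; rewrite scaleN1r addNr scaleN1r addNr. Qed.

Lemma dform0 : dform (0 : form) = 0.
Proof. by have := dform_lin (-1) 0 0; rewrite scaleN1r addNr scaleN1r addNr. Qed.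

Lemma fmul0r p : fmul p (0 : form) = 0.
Proof. by have := fmul_lin p (-1) 0 0; rewrite scaleN1r addNr scaleN1r addNr. Qed.

Lemma wedgeNr v w : wedge v (- w) = - wedge v w.
Proof. by have := wedge_lin v (-1) w 0; rewrite !scaleN1r wedge0r !addr0. Qed.

Lemma dformN w : dform (- w) = - dform w.
Proof. by have := dform_lin (-1) w 0; rewrite !scaleN1r dform0 !addr0. Qed.

Lemma fmulN p w : fmul p (- w) = - fmul p w.
Proof. by have := fmul_lin p (-1) w 0; rewrite !scaleN1r fmul0r !addr0. Qed.

Lemma fmulA p q w : fmul p (fmul q w) = fmul (p * q) w.
Proof. by apply/ffunP => K; rewrite !ffunE mulrA. Qed.

Lemma log_form_lin h c (k : C) w w' :
  log_form h c w -> log_form h c w' -> log_form h c (k *: w + w').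
Proof.
move=> [cw Dw] [cw' Dw']; split=> [I cI|K].
  by rewrite !ffunE cw // cw' // scaler0 addr0.
rewrite wedge_lin formD formZ; apply: mdvdD => //.
by rewrite -mul_mpolyC; apply: mdvd_mull; exact: Dw.
Qed.

Lemma log_form0 h c : log_form h c (0 : form).
Proof.
by split=> [I _|K]; [rewrite ffunE|rewrite wedge0r ffunE; exact: mdvd0].
Qed.

Lemma log_formN h c w : log_form h c w -> log_form h c (- w).
Proof.
by move=> lw; have := log_form_lin (-1) lw (log_form0 h c); rewrite scaleN1r addr0.
Qed.

Lemma finsupp1_tau0 (U : zmodType) (v : U) : finsupp1 (tau0 v).
Proof. by exists 0%N => i; rewrite /tau0; case: eqP => // ->. Qed.

Lemma log_tau_lin h c (k : C) a b :
  log_tau h c a -> log_tau h c b -> log_tau h c (k *: a + b).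
Proof.
move=> [[N NP] la] [[M MP] lb]; split=> [|i]; last exact: log_form_lin.
exists (maxn N M) => i; rewrite gtn_max => /andP[iN iM].
by rewrite -[LHS]/(k *: a i + b i) NP // MP // scaler0 addr0.
Qed.

Lemma log_tau0 h c : log_tau h c (0 : int -> form).
Proof. by split=> [|i]; [exists 0%N|exact: log_form0]. Qed.

Lemma log_tauD h c a b : log_tau h c a -> log_tau h c b -> log_tau h c (a + b).
Proof. by move=> la lb; rewrite -[a]scale1r; exact: log_tau_lin. Qed.

Lemma log_tauN h c a : log_tau h c a -> log_tau h c (- a).
Proof.
move=> la; rewrite -scaleN1r -[_ *: _]addr0; apply: log_tau_lin => //.
exact: log_tau0.
Qed.

Lemma log_tauB h c a b : log_tau h c a -> log_tau h c b -> log_tau h c (a - b).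
Proof. by move=> la lb; apply: log_tauD => //; exact: log_tauN. Qed.

Lemma log_tau_tau0 h c w : log_form h c w -> log_tau h c (tau0 w).
Proof.
move=> lw; split=> [|i]; first exact: finsupp1_tau0.
by rewrite /tau0; case: eqP => // _; exact: log_form0.
Qed.

Lemma log_tau_shift h c a (k : int) : log_tau h c a -> log_tau h c (fun i => a (i + k)).
Proof.
move=> [[N NP] la]; split=> [|i]; last exact: la.
by exists (N + absz k)%N => i ik; apply: NP; lia.
Qed.

Lemma log_tau_mul h c a : log_tau h c a -> log_tau h c (tau_mul a).
Proof. exact: (@log_tau_shift h c a (-1)). Qed.

(** The right-hand side of [GMt_zero] at one exponent of tau, [b'] being the coefficient of b at the
    preceding exponent. *)
Definition GMt_rel h f t (b b' z e : form) : form :=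
  fmul h (dform b) - wedge (dfun h) b - fmul h (wedge (dfun f) b')
  + wedge (dfun h) z + fmul h (fmul (h - t%:MP) e).

Lemma GMt_rel_lin h f t (c : C) (b1 b1' z1 e1 b2 b2' z2 e2 : form) :
  GMt_rel h f t (c *: b1 + b2) (c *: b1' + b2') (c *: z1 + z2) (c *: e1 + e2) =
  c *: GMt_rel h f t b1 b1' z1 e1 + GMt_rel h f t b2 b2' z2 e2.
Proof.
rewrite /GMt_rel dform_lin (wedge_lin _ c b1) (wedge_lin _ c b1').
rewrite (wedge_lin _ c z1) (fmul_lin _ c (dform b1)) (fmul_lin _ c e1).
rewrite (fmul_lin _ c (fmul _ e1)) (fmul_lin _ c (wedge _ b1')).
by rewrite -!lin_opp -!lin_add.
Qed.

Section Zero.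
Context (h f : cpoly) (t : C).

Lemma GMt_zero_lin (c : C) a b :
  GMt_zero h f t a -> GMt_zero h f t b -> GMt_zero h f t (c *: a + b).
Proof.
move=> [b1 [z1 [e1 [lb1 lz1 le1 E1]]]] [b2 [z2 [e2 [lb2 lz2 le2 E2]]]].
exists (c *: b1 + b2), (c *: z1 + z2), (c *: e1 + e2).
split=> [|||i]; try exact: log_tau_lin.
rewrite -[RHS]/(GMt_rel h f t (c *: b1 i + b2 i) (c *: b1 (i - 1) + b2 (i - 1))
  (c *: z1 i + z2 i) (c *: e1 i + e2 i)).
rewrite GMt_rel_lin -[LHS]/(fmul h (c *: a i + b i)).
rewrite fmul_lin E1 E2.
reflexivity.
Qed.

Lemma GMt_zero0 : GMt_zero h f t 0.
Proof.
exists 0, 0, 0; split; try exact: log_tau0.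
by move=> i; rewrite /= !(fmul0r, dform0, wedge0r) !(subr0, addr0, oppr0).
Qed.

Lemma GMt_zero_tau a : GMt_zero h f t a -> GMt_zero h f t (tau_mul a).
Proof.
move=> [b [z [e [lb lz le E]]]]; exists (tau_mul b), (tau_mul z), (tau_mul e).
by split=> [|||i]; try exact: log_tau_mul; exact: E.
Qed.

Lemma GMt_zero_ht e : log_tau h 1 e ->
  GMt_zero h f t (fun i => fmul (h - t%:MP) (e i)).
Proof.
move=> le; exists 0, 0, e; split=> // [||i]; try exact: log_tau0.
by rewrite /= !(fmul0r, dform0, wedge0r) !(subr0, addr0, oppr0) add0r.
Qed.

Lemma Glat_lin k (c : C) a b : Glat h f t k a -> Glat h f t k b ->
  Glat h f t k (c *: a + b).
Proof.
move=> [la [a' [la' sa' za]]] [lb [b' [lb' sb' zb]]].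
split; first exact: log_tau_lin.
exists (c *: a' + b'); split; first exact: log_tau_lin.
  move=> i ki; rewrite -[LHS]/(c *: a' i + b' i).
  by rewrite sa' // sb' // scaler0 addr0.
have -> : c *: a + b - (c *: a' + b') = c *: (a - a') + (b - b').
  by rewrite scalerBr opprD addrACA.
exact: GMt_zero_lin.
Qed.

Lemma Glat_supp k a : log_tau h 1 a -> (forall i, k < i -> a i = 0) ->
  Glat h f t k a.
Proof.
by move=> la sa; split=> //; exists a; split=> //; rewrite subrr; exact: GMt_zero0.
Qed.

Lemma Glat0 k : Glat h f t k 0.
Proof. by apply: Glat_supp => //; exact: log_tau0. Qed.

Lemma GlatD k a b : Glat h f t k a -> Glat h f t k b -> Glat h f t k (a + b).
Proof. by move=> *; rewrite -[a]scale1r; exact: Glat_lin. Qed.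

Lemma Glat_zero k a : log_tau h 1 a -> GMt_zero h f t a -> Glat h f t k a.
Proof.
by move=> la za; split=> //; exists 0; split=> //; [exact: log_tau0|rewrite subr0].
Qed.

Lemma Glat_tau0 w : log_form h 1 w -> Glat h f t 0 (tau0 w).
Proof.
move=> lw; apply: Glat_supp; first exact: log_tau_tau0.
by move=> i i0; rewrite /tau0 gt_eqF.
Qed.

Lemma Glat_tau_mul k a : Glat h f t k a -> Glat h f t (k + 1) (tau_mul a).
Proof.
move=> [la [a' [la' sa' za]]]; split; first exact: log_tau_mul.
exists (tau_mul a'); split; first exact: log_tau_mul.
  by move=> i ki; apply: sa'; lia.
exact: (GMt_zero_tau za).
Qed.

End Zero.

(** * Classes p w, and relations between them modulo tau^-1 *)

Definition gclass p : int -> form := tau0 (fmul p euler_form).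

Lemma tau0_lin (c : C) w w' : tau0 (c *: w + w') = c *: tau0 w + tau0 w'.
Proof.
apply/funext => i; rewrite -[RHS]/(c *: tau0 w i + tau0 w' i) /tau0.
by case: eqP; rewrite ?scaler0 ?addr0.
Qed.

Lemma gclass_lin (c : C) p q : gclass (c *: p + q) = c *: gclass p + gclass q.
Proof. by rewrite /gclass fmulr_lin tau0_lin. Qed.

Lemma gclassD p q : gclass (p + q) = gclass p + gclass q.
Proof. by have := gclass_lin 1 p q; rewrite !scale1r. Qed.

Lemma gclass0 : gclass 0 = 0.
Proof. by have := gclass_lin (-1) 0 0; rewrite scaleN1r addNr scaleN1r addNr. Qed.

Lemma gclassZ (c : C) p : gclass (c *: p) = c *: gclass p.
Proof. by have := gclass_lin c p 0; rewrite gclass0 !addr0. Qed.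

Lemma gclassB p q : gclass (p - q) = gclass p - gclass q.
Proof. by rewrite gclassD -scaleN1r gclassZ scaleN1r. Qed.

Section Reduced.
Context (h f : cpoly).
Context (n0 : (0 < n)%N) (hH : h \is n.-homog) (fH : f \is 1.-homog).

Let n_neq0 : (n%:R : C) != 0.
Proof. by rewrite pnatr_eq0 -lt0n. Qed.

Lemma log_gclass p : log_tau h 1 (gclass p).
Proof. exact/log_tau_tau0/(log_euler_form _ hH). Qed.

Lemma killM chi p : lie chi h = 0 -> lie (fun i => p * chi i) h = 0.
Proof. by move=> chih; rewrite lieMl chih mulr0. Qed.

(** The factor -1/n compensates E(h) = n h in [wedge_star2]. *)
Lemma wedge_dh_star2 p chi : lie chi h = 0 ->
  wedge (dfun h) (star2 (fun i => (- (n%:R^-1 *: p)) * chi i)) =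
  fmul h (star1 (fun i => p * chi i)).
Proof.
move=> chih; rewrite wedge_star2 (killM _ chih) (lieX hH) star1M.
apply: eq_star1 => k; rewrite mul0r sub0r mulNr mulrN opprK -scalerAl.
by rewrite -scalerAl -scalerAr scalerA divff // scale1r.
Qed.

(* Omega^{n-1}(log h) = Der(-log D) / Der(-log h): a logarithmic field killing h
   gives an element of dh/h /\ Omega^{n-2}(log D). *)
Lemma GMt_zero_kill t chi : lie chi h = 0 -> GMt_zero h f t (tau0 (star1 chi)).
Proof.
move=> chih; exists 0, (tau0 (star2 (fun i => (- (n%:R^-1 *: 1)) * chi i))), 0.
split; try exact: log_tau0.
  exact/log_tau_tau0/(log_form_star2 hH)/killM.
move=> i; rewrite /= !(fmul0r, dform0, wedge0r) !(subr0, addr0, oppr0) add0r.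
rewrite /tau0; case: eqP => _; last by rewrite wedge0r fmul0r.
by rewrite wedge_dh_star2 //; congr fmul; apply: eq_star1 => k; rewrite mul1r.
Qed.

(** For B = [star2 chi] with chi(h) = 0, the numerator h dB - dh /\ B is h times the contraction by
    this field. *)
Definition div_part chi k : cpoly :=
  \sum_j (chi j * 'X_k - chi k * 'X_j)^`M(j) + n%:R *: chi k.

(** In invariant terms the field is div(chi) E - [E, chi]. *)
Lemma div_partE chi k : div_part chi k =
  (\sum_j (chi j)^`M(j)) * 'X_k + chi k - \sum_j 'X_j * (chi k)^`M(j).
Proof.
have D j : (chi j * 'X_k - chi k * 'X_j)^`M(j) = (chi j)^`M(j) * 'X_k +
    chi j * (k == j)%:R - ('X_j * (chi k)^`M(j) + chi k).
  by rewrite mderivB !mderivM !mderiv_X eqxx mulr1 [_ * 'X_j]mulrC.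
rewrite /div_part (eq_bigr _ (fun j _ => D j)) sumrB.
rewrite (big_split _ _ _ (fun j => (chi j)^`M(j) * 'X_k) (fun j => chi j * (k == j)%:R)).
rewrite (big_split _ _ _ (fun j => 'X_j * (chi k)^`M(j)) (fun=> chi k)) /=.
rewrite -mulr_suml sumr_const card_ord scaler_nat opprD addrA subrK.
congr (_ + _ - _); rewrite (bigD1 k) //= eqxx mulr1 big1 ?addr0 // => j.
by rewrite eq_sym => /negbTE ->; rewrite mulr0.
Qed.

(** The bracket [E, chi] kills h along with chi, and div(chi) E multiplies h by n div(chi). *)
Lemma div_part_log chi : lie chi h = 0 -> mdvd h (lie (div_part chi) h).
Proof.
move=> chih.
(* Applying E to chi(h) = 0 leaves the terms chi_k E(d_k h) = (n - 1) chi_k d_k h, which sum to a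
   multiple of chi(h). *)
have comm : \sum_k (\sum_j 'X_j * (chi k)^`M(j)) * h^`M(k) = 0.
  under eq_bigr => k _ do rewrite mulr_suml.
  rewrite exchange_big /=.
  transitivity (\sum_j 'X_j * ((lie chi h)^`M(j) - \sum_k chi k * h^`M(j)^`M(k))).
    apply: eq_bigr => j _; rewrite /lie (raddf_sum (mderiv j)) -sumrB mulr_sumr.
    by apply: eq_bigr => k _; rewrite /= mderivM mderiv_comm; ring.
  under eq_bigr => j _ do rewrite chih mderiv0 sub0r mulrN mulr_sumr.
  rewrite sumrN exchange_big /=; apply/eqP; rewrite oppr_eq0; apply/eqP.
  transitivity ((n.-1)%:R *: lie chi h); last by rewrite chih scaler0.
  rewrite /lie scaler_sumr; apply: eq_bigr => k _.
  have hk : h^`M(k) \is (n.-1).-homog by apply: deriv_homog; rewrite prednK.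
  rewrite scalerAr -(euler hk) mulr_sumr; apply: eq_bigr => j _.
  by rewrite mderiv_comm mulrCA.
rewrite /lie; under eq_bigr => k _ do rewrite div_partE mulrBl mulrDl.
rewrite sumrB comm subr0 big_split /= -/(lie chi h) chih addr0.
under eq_bigr => k _ do rewrite -mulrA.
rewrite -mulr_sumr (euler hH) -mul_mpolyC; exists ((\sum_j (chi j)^`M(j)) * n%:R%:MP).
by rewrite mulrA.
Qed.

(* The relation (d - tau df) applied to the contraction of the volume form by
   chi /\ Euler reads tau chi(f) = (terms without tau). *)
Lemma Glat_lie t chi : lie chi h = 0 -> Glat h f t (-1) (gclass (lie chi f)).
Proof.
move=> chih; pose B := star2 chi.
split; first exact: log_gclass.
pose at_m1 (v : form) : int -> form := fun i => if i == -1 then v else 0.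
have log_m1 c v : log_form h c v -> log_tau h c (at_m1 v).
  move=> lv; split=> [|i]; first by exists 1%N => i; rewrite /at_m1; case: eqP => // ->.
  by rewrite /at_m1; case: eqP => // _; exact: log_form0.
have lB : log_form h 2 B := log_form_star2 hH chih.
have la' := log_m1 _ _ (log_form_star1 (div_part_log chih)).
exists (at_m1 (star1 (div_part chi))); split=> // [i|].
  by rewrite /at_m1; case: eqP => // ->.
(* With b = - tau^-1 B the term at tau^0 is df /\ B, the contraction by chi(f) E - f chi; z restores
   f chi, and [div_part] remains at tau^-1. *)
exists (at_m1 (- B)), (tau0 (star2 (fun i => (- (n%:R^-1 *: f)) * chi i))), 0.
split; [exact/log_m1/log_formN|exact/log_tau_tau0/(log_form_star2 hH)/killM|
  exact: log_tau0|].
move=> i; rewrite -[(_ - at_m1 _) i]/(gclass (lie chi f) i - at_m1 (star1 (div_part chi)) i).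
rewrite -[(0 : int -> form) i]/(0 : form) !fmul0r addr0 /at_m1 /gclass /tau0.
have [->|i0] := eqVneq i 0.
  rewrite /= subr0 !(dform0, wedge0r, fmul0r) subrr sub0r wedgeNr fmulN opprK.
  rewrite wedge_dh_star2 // wedge_star2 (lieX fH) scale1r /euler_form !star1M star1D.
  by apply: eq_star1 => k; ring.
have [->|i1] := eqVneq i (-1).
  rewrite /= sub0r !(dform0, wedge0r, fmul0r) subr0 addr0 dformN wedgeNr !fmulN opprK.
  rewrite dform_star2 wedge_star2 chih (lieX hH) !star1M !star1N star1D.
  by apply: eq_star1 => k; rewrite /div_part -!mul_mpolyC; ring.
have -> : (i - 1 == -1) = false.
  by apply/negbTE; move: i0; apply: contra_neq => E; lia.
by rewrite !subrr !(dform0, wedge0r, fmul0r) !subr0 addr0.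
Qed.

Lemma Glat_jac t p : jac h f t p -> Glat h f t (-1) (gclass p).
Proof.
move=> [chi [q [chih ->]]]; rewrite gclassD; apply: GlatD; first exact: Glat_lie.
apply: Glat_zero; first exact: log_gclass.
have -> : gclass (q * (h - t%:MP)) = fun i => fmul (h - t%:MP) (gclass q i).
  apply/funext => i; rewrite /gclass /tau0; case: eqP => _; last by rewrite fmul0r.
  by rewrite fmulA mulrC.
exact/GMt_zero_ht/log_gclass.
Qed.

(** Every logarithmic field splits as p E plus a field killing h, with p = chi(h)/(n h), and the
    second part is zero in G_t. *)
Lemma Glat_gclass t a : Glat h f t 0 a ->
  exists p, Glat h f t (-1) (a - gclass p).
Proof.
move=> [la [a' [la' sa' za]]].
have [chi [r rE] a0] := log_form1P (la'.2 0).
pose p : cpoly := n%:R^-1 *: r; exists p.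
pose chi1 i := chi i - p * 'X_i.
have chi1h : lie chi1 h = 0.
  transitivity (lie (fun i => chi i + (- p) * 'X_i) h).
    by apply: eq_bigr => i _; rewrite mulNr.
  rewrite lieDl lieMl (lieX hH) rE mulNr -scalerAl -scalerAr scalerA mulVf //.
  by rewrite scale1r subrr.
have a0E : tau0 (a' 0) = gclass p + tau0 (star1 chi1).
  apply/funext => i; rewrite -[RHS]/(gclass p i + tau0 (star1 chi1) i) /gclass /tau0.
  case: eqP => _; last by rewrite addr0.
  by rewrite a0 /euler_form star1M star1D; apply: eq_star1 => k; rewrite /chi1 addrC subrK.
have lchi1 : log_tau h 1 (tau0 (star1 chi1)).
  by apply/log_tau_tau0/log_form_star1; rewrite chi1h; exact: mdvd0.
have -> : a - gclass p = (a - a') + tau0 (star1 chi1) + (a' - tau0 (a' 0)).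
  by rewrite a0E addrACA subrK opprD [- gclass p + _]addrC addNKr.
apply: GlatD; first apply: GlatD.
- apply: Glat_zero => //; exact: log_tauB.
- by apply: Glat_zero => //; exact: GMt_zero_kill.
apply: Glat_supp; first by apply: log_tauB => //; apply/log_tau_tau0/la'.2.
move=> i i1; rewrite -[LHS]/(a' i - tau0 (a' 0) i) /tau0.
case: eqP => [->|i0]; first by rewrite subrr.
by rewrite sa' ?subr0 //; lia.
Qed.

End Reduced.
End Lattices.

(** * The pairing on G_0 / tau^-1 G_0 *)

Section Residue.
Context {R : realType} {n : nat}.
Local Notation C := (complex R).
Local Notation cpoly := {mpoly C[n]}.
Local Notation form := (extform R n).
Local Notation ps := (@ps_of_mpoly R n).
Implicit Types (p q h f l : cpoly) (chi : 'I_n -> cpoly) (t : C) (w : form).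
Implicit Types (a b e z : int -> form).

Lemma log_tau_t0 h c a : log_tau h c a -> log_tau_t h c (t0 a).
Proof.
move=> [[N NP] la]; split=> [|i j].
  exists N => i j ij; rewrite /t0; case: eqP => // j0.
  by move: ij; rewrite j0 /= ltn0 orbF => /NP.
by rewrite /t0; case: eqP => // _; exact: log_form0.
Qed.

Lemma log_tau_t_mul2 h c (A : int -> int -> form) :
  log_tau_t h c A -> log_tau_t h c (t_mul2 A).
Proof.
move=> [[N NP] lA]; split=> [|i j]; last exact: lA.
exists N.+1 => i j ij; apply: NP; lia.
Qed.

Lemma log_tau_t_lin h c (k : C) (A B : int -> int -> form) :
  log_tau_t h c A -> log_tau_t h c B -> log_tau_t h c (k *: A + B).
Proof.
move=> [[N NP] lA] [[M MP] lB]; split=> [|i j]; last exact: log_form_lin.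
exists (maxn N M) => i j ij; rewrite -[LHS]/(k *: A i j + B i j).
by rewrite NP ?MP ?scaler0 ?addr0 //; lia.
Qed.

Lemma t0_lin (c : C) a b : t0 (c *: a + b) = c *: t0 a + t0 b.
Proof.
apply/funext => i; apply/funext => j.
rewrite -[RHS]/(c *: t0 a i j + t0 b i j) /t0.
by case: eqP; rewrite ?scaler0 ?addr0.
Qed.

(** The coefficient X_i makes up for the missing dx_i: the numerator has weight k + n, and dividing
    by h leaves k. *)
Lemma has_weight_euler_form k p : p \is k.-homog ->
  has_weight k%:Z (fmul p (euler_form : form)).
Proof.
move=> pH I m; have [cI|cI] := eqVneq (#|I| + 1)%N n; last first.
  by rewrite (fmul_codegree p (star1_codegree _)) // mcoeff_msupp mcoeff0 eqxx.
have [i IE] := codegree1P cI.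
rewrite ffunE IE /euler_form star1E => ms.
have sH : ((-1) ^+ hodge_sign i * 'X_i : cpoly) \is 1.-homog.
  rewrite -signr_odd; case: (odd _); rewrite ?expr1 ?expr0 ?mulN1r ?mul1r ?rpredN;
  exact: X_homog.
have /dhomogP/(_ m ms) /= -> := dhomogM pH sH.
rewrite -IE -[X in _ - X%:Z]cI; move: (#|I|) => c; lia.
Qed.

Lemma homog_gclass k p : p \is k.-homog -> homog_loc k%:Z (t0 (gclass p)).
Proof.
move=> pH i j; rewrite /t0 /gclass /tau0.
case: eqP => [->|_]; last by move=> I m; rewrite ffunE mcoeff_msupp mcoeff0 eqxx.
case: eqP => [->|_]; last by move=> I m; rewrite ffunE mcoeff_msupp mcoeff0 eqxx.
by rewrite mulr0 subr0 addr0; exact: has_weight_euler_form.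
Qed.

Section Pairing.
Context (h f : cpoly) (P : C -> @pairing_t R n) (S : @pairing_loc R n).
Context (n0 : (0 < n)%N) (hH : h \is n.-homog) (fH : f \is 1.-homog).
Context (HS : hypothesis_H h f P S).

Let PS := H_pairing HS.
Let le0 a := forall i : int, 0 < i -> a i = 0.

Definition residue p q : C := S (t0 (gclass p)) (t0 (gclass q)) (1 - n%:Z) 0.
Local Notation Q := residue.

Let lt0g p : log_tau_t h 1 (t0 (gclass p)).
Proof. exact/log_tau_t0/log_gclass. Qed.

Lemma residue_linl (c : C) p q r : Q (c *: p + q) r = c * Q p r + Q q r.
Proof. by rewrite /Q gclass_lin t0_lin (pl_linl PS). Qed.

Lemma residue_linr (c : C) p q r : Q r (c *: p + q) = c * Q r p + Q r q.
Proof. by rewrite /Q gclass_lin t0_lin (pl_linr PS). Qed.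

Lemma residue0l q : Q 0 q = 0.
Proof. by have := residue_linl (-1) 0 0 q; rewrite scaleN1r addNr mulN1r addNr. Qed.

Lemma residue0r q : Q q 0 = 0.
Proof. by have := residue_linr (-1) 0 0 q; rewrite scaleN1r addNr mulN1r addNr. Qed.

Lemma residueDl p q r : Q (p + q) r = Q p r + Q q r.
Proof. by rewrite -[p]scale1r residue_linl scale1r mul1r. Qed.

Lemma residueDr p q r : Q r (p + q) = Q r p + Q r q.
Proof. by rewrite -[p]scale1r residue_linr scale1r mul1r. Qed.

Lemma residueZl (c : C) p r : Q (c *: p) r = c * Q p r.
Proof. by have := residue_linl c p 0 r; rewrite residue0l !addr0. Qed.

Lemma residueZr (c : C) p r : Q r (c *: p) = c * Q r p.
Proof. by have := residue_linr c p 0 r; rewrite residue0r !addr0. Qed.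

Lemma residue_suml I (s : seq I) (F : I -> cpoly) r :
  Q (\sum_(i <- s) F i) r = \sum_(i <- s) Q (F i) r.
Proof. by elim/big_rec2: _ => [|i y x _ <-]; rewrite ?residue0l ?residueDl. Qed.

Lemma residue_sumr I (s : seq I) (F : I -> cpoly) r :
  Q r (\sum_(i <- s) F i) = \sum_(i <- s) Q r (F i).
Proof. by elim/big_rec2: _ => [|i y x _ <-]; rewrite ?residue0r ?residueDr. Qed.

Lemma pairing_tau_up a b : log_tau h 1 a -> log_tau h 1 b ->
  forall i j, S (t0 a) (t0 b) i j = S (t0 (fun i => a (i + 1))) (t0 b) (i - 1) j.
Proof.
move=> la lb i j; have -> : t0 a = tau_mul2 (t0 (fun i => a (i + 1))).
  apply/funext => i'; apply/funext => j'; rewrite /tau_mul2 /t0.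
  by case: eqP => // _; rewrite subrK.
by rewrite (pl_taul PS) //; apply: log_tau_t0 => //; exact: log_tau_shift.
Qed.

(** Multiplication by tau does not affect powers of t, so induction on the largest power of tau in a
    reduces to (H)(2). *)
Lemma pairing_t_nonneg a b : log_tau h 1 a -> log_tau h 1 b -> le0 b ->
  forall i j, S (t0 a) (t0 b) i j != 0 -> 0 <= j.
Proof.
move=> la lb sb; have [N NP] := la.1.
have : forall i : int, N%:Z < i -> a i = 0 by move=> i Ni; apply: NP; lia.
elim: N a la {NP} => [|N IH] a la sa i j.
  by move=> /(H_G HS la lb sa sb)[].
rewrite pairing_tau_up //; apply: IH; first exact: log_tau_shift.
by move=> k Nk; apply: sa; lia.
Qed.

(** Since tau a still has no positive powers of tau, (H)(2) bounds S(tau a, b) by tau^(1-n), hence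
    S(a, b) by tau^(-n). *)
Lemma pairing_lead_neg a b : log_tau h 1 a -> log_tau h 1 b ->
  (forall i : int, -1 < i -> a i = 0) -> le0 b ->
  forall j, S (t0 a) (t0 b) (1 - n%:Z) j = 0.
Proof.
move=> la lb sa sb j; apply/eqP; apply: contraT => nz.
have lsh := log_tau_shift (-1) la.
have := pairing_tau_up lsh lb (2%:Z - n%:Z) j.
have -> : (fun i : int => a (i + 1 - 1)) = a by apply/funext => i; rewrite addrK.
have -> : 2%:Z - n%:Z - 1 = 1 - n%:Z by lia.
move=> E; move: nz; rewrite -E => /(H_G HS lsh lb _ sb).
by case=> [i i0|]; [apply: sa|]; lia.
Qed.

Lemma gclass_le0 p : le0 (gclass p).
Proof. by move=> i i0; rewrite /gclass /tau0 gt_eqF. Qed.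

(* In G the multiplication by h is t, which raises the degree in t; hence
   (1 - n, 0)-coefficients only depend on classes in G_0. *)
Lemma residue_Glat p q : Glat h f 0 (-1) (gclass p) -> Q p q = 0.
Proof.
move=> [la [a' [la' sa' [b [z [e [lb lz le E]]]]]]].
(* Modulo the other relations A is h e; as h acts as t, it agrees with T = t e in the localized
   module. *)
pose B := t0 (gclass q); pose T := t_mul2 (t0 e); pose A := t0 (gclass p - a').
have lB : log_tau_t h 1 B := lt0g q.
have lT : log_tau_t h 1 T by apply/log_tau_t_mul2/log_tau_t0.
have lA : log_tau_t h 1 A by apply/log_tau_t0/log_tauB.
have zero : GMloc_zero h f ((-1) *: T + A).
  exists (t0 b), (t0 z), (t0 (- e)); split; try exact: log_tau_t0.
    by apply/log_tau_t0/log_tauN.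
  move=> i j; rewrite -[X in fmul h X]/(-1 *: T i j + A i j) scaleN1r.
  rewrite /T /A /t_mul2 /t0; have [->|j0] := eqVneq j 0.
    rewrite /= oppr0 add0r E sub0r -[(- e) i]/(- e i) (fmulN h (e i)) opprK.
    by rewrite mpolyC0 subr0.
  have [->|j1] := eqVneq j 1.
    rewrite subrr eqxx addr0 -[(- e) i]/(- e i).
    by rewrite !(fmul0r, dform0, wedge0r) !(subr0, addr0, oppr0) add0r.
  rewrite subr_eq0 (negbTE j1).
  by rewrite !(fmul0r, dform0, wedge0r, subr0, addr0, oppr0).
have SAT : S A B (1 - n%:Z) 0 = 0.
  have := pl_zerol PS (log_tau_t_lin (-1) lT lA) lB zero.
  rewrite (pl_linl PS) // scaleN1r addrC => /subr0_eq ->.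
  rewrite (pl_tl PS) //; last exact: log_tau_t0.
  apply/eqP; apply: contraT.
  by move=> /(pairing_t_nonneg le (log_gclass hH q) (@gclass_le0 q)).
have t0E : t0 (gclass p) = 1 *: A + t0 a'.
  by rewrite -t0_lin scale1r subrK.
rewrite /Q t0E (pl_linl PS) //; last exact: log_tau_t0.
rewrite scale1r -[LHS]/(S A B (1 - n%:Z) 0 + S (t0 a') B (1 - n%:Z) 0) SAT add0r.
exact: (pairing_lead_neg la' (log_gclass hH q) sa' (@gclass_le0 q)).
Qed.

Lemma residue_jacl p q : jac h f 0 p -> Q p q = 0.
Proof. by move=> /(Glat_jac n0 hH fH)/residue_Glat. Qed.

(** The monomial tau^(1-n) t^0 has degree n - 1. *)
Lemma residue_homog k m p q : p \is k.-homog -> q \is m.-homog ->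
  (k + m)%N != n.-1 -> Q p q = 0.
Proof.
move=> pH qH km; apply/eqP; apply: contraNT km => nz.
have := H_homog HS (lt0g p) (lt0g q) (homog_gclass pH) (homog_gclass qH) nz.
by rewrite mulr0 => E; apply/eqP; lia.
Qed.

(** At t = 1 all powers t^j contribute, but (H)(2) gives j >= 0 and homogeneity gives n j + n - 1 =
    k + m < 2 n - 1, so only j = 0 survives. *)
Lemma residue_pairing k m p q : p \is k.-homog -> q \is m.-homog ->
  (k + m < (n + n).-1)%N -> P 1 (gclass p) (gclass q) (1 - n%:Z) = Q p q.
Proof.
move=> pH qH km; rewrite (H_induces HS) ?oner_neq0 //; try exact: log_gclass.
rewrite -(fsbig_widen [set 0%R : int]%classic) //=.
  by rewrite fsbig_set1 expr0z mulr1.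
move=> j [_ j0] /=; rewrite exp1rz mulr1; apply/eqP; apply: contraT => nz.
have jge := (H_G HS (log_gclass hH p) (log_gclass hH q)
  (@gclass_le0 p) (@gclass_le0 q) nz).2.
have E := H_homog HS (lt0g p) (lt0g q) (homog_gclass pH) (homog_gclass qH) nz.
have {}j0 : j != 0 by apply/eqP.
have : n%:Z * 1 <= n%:Z * j by rewrite ler_pM2l; lia.
by lia.
Qed.

(** * Symmetry, invariance and non-degeneracy of the residue form *)

Context (V : rat -> set (int -> form)).
Context (hP : sabbah_pairing h f 1 V (P 1)).

(** On homogeneous arguments both sides vanish or are leading coefficients of the symmetric pairing
    on G_1. *)
Lemma residue_sym p q : Q p q = Q q p.
Proof.
suff main : forall k m p' q', p' \is k.-homog -> q' \is m.-homog -> Q p' q' = Q q' p'.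
  rewrite (sum_hcomp p) (sum_hcomp q) !residue_suml; under [RHS]eq_bigr => i _ do
    rewrite residue_sumr.
  rewrite exchange_big /=; apply: eq_bigr => i _; rewrite residue_sumr.
  by apply: eq_bigr => j _; apply: main; exact: hcomp_homog.
move=> k m p' q' pH qH; have [km|km] := eqVneq (k + m)%N n.-1; last first.
  by rewrite (residue_homog pH qH) // (residue_homog qH pH) // addnC.
have km' : (k + m < (n + n).-1)%N by lia.
rewrite -(residue_pairing pH qH km') -(residue_pairing qH pH); last by rewrite addnC.
by apply: (sp_lead_sym hP); apply/Glat_tau0/(log_euler_form _ hH).
Qed.

Lemma nabla_gclass p : nabla_tau f (gclass p) = - gclass (f * p).
Proof.
apply/funext => i; rewrite /nabla_tau -[RHS]/(- gclass (f * p) i) /ddtau.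
have -> : gclass p (i + 1) *~ (i + 1) = 0.
  by rewrite /gclass /tau0; case: eqP => [->|_]; [exact: mulr0z|exact: mul0rz].
rewrite sub0r; congr (- _); rewrite /gclass /tau0.
by case: eqP => _; [exact: fmulA|exact: fmul0r].
Qed.

(* The flatness of the pairing, read on leading terms. *)
Lemma residue_mulf p q : Q (f * p) q = Q p (f * q).
Proof.
suff main : forall k m p' q', p' \is k.-homog -> q' \is m.-homog ->
    Q (f * p') q' = Q p' (f * q').
  rewrite (sum_hcomp p) (sum_hcomp q) !mulr_sumr !residue_suml.
  apply: eq_bigr => i _; rewrite !residue_sumr; apply: eq_bigr => j _.
  by apply: main; exact: hcomp_homog.
move=> k m p' q' pH qH; have fpH := dhomogM fH pH; have fqH := dhomogM fH qH.
have [km|km] := eqVneq (1 + k + m)%N n.-1; last first.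
  by rewrite (residue_homog fpH qH) // (residue_homog pH fqH) // addnCA addnA.
rewrite -(residue_pairing fpH qH); last lia.
rewrite -(residue_pairing pH fqH); last lia.
have lg r := log_gclass hH r.
have := sp_flat hP (lg p') (lg q'); rewrite !nabla_gclass.
have PT := sp_pairing hP.
have PNl a b : log_tau h 1 a -> log_tau h 1 b -> P 1 (- a) b = - P 1 a b.
  move=> la lb; have := pt_linl PT (-1) la (log_tau0 h 1) lb.
  rewrite !scaleN1r addr0 => ->.
  have := pt_linl PT (-1) (log_tau0 h 1) (log_tau0 h 1) lb.
  by rewrite scaler0 addr0 scaleN1r addNr => ->; rewrite addr0.
have PNr a b : log_tau h 1 a -> log_tau h 1 b -> P 1 a (- b) = - P 1 a b.
  move=> la lb; have := pt_linr PT (-1) la lb (log_tau0 h 1).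
  rewrite !scaleN1r addr0 => ->.
  have := pt_linr PT (-1) la (log_tau0 h 1) (log_tau0 h 1).
  by rewrite scaler0 addr0 scaleN1r addNr => ->; rewrite addr0.
rewrite PNl // PNr // => /(congr1 (fun u : int -> C => u (1 - n%:Z))).
(* The coefficient of the derivative at tau^(1-n) comes from tau^(2-n), which does not occur in a
   pairing of elements of G_1. *)
rewrite /ddtau (sp_G hP); first last.
- lia.
- by apply/Glat_tau0/(log_euler_form _ hH).
- by apply/Glat_tau0/(log_euler_form _ hH).
rewrite mul0rz opprK -[RHS]/(- P 1 (gclass (f * p')) (gclass q') (1 - n%:Z)
  + P 1 (gclass p') (gclass (f * q')) (1 - n%:Z)).
by move=> /esym/eqP; rewrite addrC subr_eq0 => /eqP.
Qed.

Context (l : cpoly) (lH : l \is 1.-homog) (lf : l = f \/ n = 1%N).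
Context (span : forall t p, exists c : 'I_n -> C,
  jac h f t (p - \sum_k c k *: l ^+ k)).

Lemma residue_jacr p q : jac h f 0 q -> Q p q = 0.
Proof. by rewrite residue_sym; exact: residue_jacl. Qed.

(** Flatness moves the factors f across one at a time; for [n = 1] only [k = 0] occurs. *)
Lemma residue_power k q : (k < n)%N -> Q (l ^+ k) q = Q 1 (l ^+ k * q).
Proof.
elim: k q => [|k IH] q kn; first by rewrite expr0 mul1r.
have [lf'|n1] := lf; last by lia.
have E r : Q (l * r) q = Q r (l * q) by rewrite lf'; exact: residue_mulf.
rewrite exprS (E (l ^+ k)) (IH (l * q) (ltnW kn)); congr (Q 1 _).
by rewrite mulrA; congr (_ * _); exact: mulrC.
Qed.

(** Elements of the ideal are orthogonal to everything on either side, so p may be replaced by a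
    combination of powers of l. *)
Lemma residue_mul p q : Q p q = Q 1 (p * q).
Proof.
have [c cP] := span 0 p.
have E r : Q (\sum_k c k *: l ^+ k) r = Q 1 ((\sum_k c k *: l ^+ k) * r).
  rewrite residue_suml mulr_suml residue_sumr; apply: eq_bigr => k _.
  by rewrite residueZl residue_power // -scalerAl residueZr.
rewrite -[p](subrK (\sum_k c k *: l ^+ k)) residueDl (residue_jacl _ cP) add0r.
have J : Q 1 ((p - \sum_k c k *: l ^+ k) * q) = 0.
  by apply: residue_jacr; rewrite mulrC; exact: jacM.
by rewrite E mulrDl residueDr J add0r.
Qed.

Lemma residue_powers k m : Q (l ^+ k) (l ^+ m) =
  if (k + m)%N == n.-1 then Q 1 (l ^+ n.-1) else 0.
Proof.
rewrite residue_mul -exprD; case: eqP => [->//|/eqP km].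
by apply: (residue_homog (dhomog1 _ _) (lin_expr_homog (k + m) lH)).
Qed.

Context (hV : KM_filtration h f 1 V) (hmin : min_spectral_simple h f 1 V).

(** The shift by tau of [pairing_lead_neg], now on the fibre t = 1. *)
Lemma pairing_lead_Glat a b : Glat h f 1 (-1) a -> Glat h f 1 0 b ->
  P 1 a b (1 - n%:Z) = 0.
Proof.
move=> Ga Gb; have la := Ga.1; have lb := Gb.1.
have := sp_G hP (Glat_tau_mul Ga) Gb (_ : 1 - n%:Z < 2%:Z - n%:Z).
rewrite (pt_taul (sp_pairing hP)) // /tau_mul.
have -> : 2%:Z - n%:Z - 1 = 1 - n%:Z by lia.
by apply; lia.
Qed.

Lemma Glat_powers a : Glat h f 1 0 a -> exists c : 'I_n -> C,
  Glat h f 1 (-1) (a - \sum_k c k *: gclass (l ^+ k)).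
Proof.
move=> Ga; have [p Gp] := Glat_gclass n0 hH fH Ga.
have [c /(Glat_jac n0 hH fH) cP] := span 1 p; exists c.
have -> : a - \sum_k c k *: gclass (l ^+ k) =
    (a - gclass p) + gclass (p - \sum_k c k *: l ^+ k).
  rewrite gclassB addrA subrK; congr (_ - _).
  elim/big_rec2: _ => [|i x y _ ->]; first by rewrite gclass0.
  by rewrite gclassD gclassZ.
exact: GlatD.
Qed.

(* Otherwise the leading form of the pairing would vanish on G_1, so that
   G_1 = tau^-1 G_1 and the spectrum would be empty. *)
Lemma residue_neq0 : Q 1 (l ^+ n.-1) != 0.
Proof.
apply/eqP => Q0.
have Glat_incr a : Glat h f 1 (-1) a -> Glat h f 1 0 a.
  move=> [la [a' [la' sa' za]]]; split=> //; exists a'; split=> // i i0.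
  by apply: sa'; lia.
have Gg p : Glat h f 1 0 (gclass p) by apply/Glat_tau0/(log_euler_form _ hH).
have PT := sp_pairing hP.
have Psub a a' b : Glat h f 1 0 a' -> Glat h f 1 0 b -> Glat h f 1 (-1) (a - a') ->
    P 1 a b (1 - n%:Z) = P 1 a' b (1 - n%:Z).
  move=> Ga' Gb Gd; have := pt_linl PT 1 Ga'.1 Gd.1 Gb.1.
  rewrite !scale1r addrC subrK => ->.
  rewrite -[LHS]/(P 1 a' b (1 - n%:Z) + P 1 (a - a') b (1 - n%:Z)).
  by rewrite (pairing_lead_Glat Gd) // addr0.
have Psum (c : 'I_n -> C) b : Glat h f 1 0 b ->
    P 1 (\sum_k c k *: gclass (l ^+ k)) b (1 - n%:Z) =
    \sum_k c k * P 1 (gclass (l ^+ k)) b (1 - n%:Z).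
  move=> Gb.
  suff [] : Glat h f 1 0 (\sum_k c k *: gclass (l ^+ k)) /\
    P 1 (\sum_k c k *: gclass (l ^+ k)) b (1 - n%:Z) =
    \sum_k c k * P 1 (gclass (l ^+ k)) b (1 - n%:Z) by [].
  elim/big_rec2: _ => [|i y x _ [Gx Ex]].
    split; first exact: Glat0.
    by rewrite (pt_zerol PT (log_tau0 h 1) Gb.1 (GMt_zero0 h f 1)).
  split; first exact: Glat_lin.
  by rewrite (pt_linl PT _ (Gg _).1 Gx.1 Gb.1) -Ex.
have Gsum (c : 'I_n -> C) : Glat h f 1 0 (\sum_k c k *: gclass (l ^+ k)).
  elim/big_rec: _ => [|i x _ Gx]; first exact: Glat0.
  exact: Glat_lin.
(* Both arguments reduce to powers of l below n, whose degrees add up to at most 2 n - 2, so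
   [residue_pairing] applies. *)
have P0 a b : Glat h f 1 0 a -> Glat h f 1 0 b -> P 1 a b (1 - n%:Z) = 0.
  move=> Ga Gb; have [c Gc] := Glat_powers Ga.
  rewrite (Psub _ _ _ (Gsum c) Gb Gc) Psum // big1 // => k _.
  have [c' Gc'] := Glat_powers Gb.
  rewrite (sp_lead_sym hP) // (Psub _ _ _ (Gsum c') (Gg _) Gc') Psum // big1 ?mulr0 //.
  move=> k' _; have kk : (k' + k < (n + n).-1)%N.
    by move: (ltn_ord k) (ltn_ord k'); lia.
  rewrite (residue_pairing (lin_expr_homog k' lH) (lin_expr_homog k lH) kk).
  by rewrite residue_powers Q0 if_same mulr0.
(* Multiplicity one provides a vector that is nonzero in the spectral quotient; being orthogonal to
   G_1 it lies in tau^-1 G_1, hence is zero there. *)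
have [alpha [[v [vA _ vfree]] _]] := hmin.
have [Vv Gv] := vA ord0.
have := vfree (fun=> 1); rewrite big_ord1 scale1r => free.
have : (1 : C) = 0.
  apply: (free _ ord0); exists 0, (v ord0); split; last by rewrite add0r.
    split; last exact: Glat0.
    exists (alpha - 1); first by rewrite ltrBlDr ltrDl.
    by apply: (km_zero hV); [exact: log_tau0|exact: GMt_zero0].
  split=> //; apply: (sp_lead_nondeg hP Gv) => b; exact: P0.
by move/eqP; rewrite oner_eq0.
Qed.

Lemma residue_nondeg p : (forall q, Q p q = 0) -> jac h f 0 p.
Proof.
move=> Qp; have [c cP] := span 0 p.
suff c0 k : c k = 0.
  by move: cP; rewrite big1 ?subr0 // => k _; rewrite c0 scale0r.
(* In the powers of l the form is antidiagonal, so this power isolates the coefficient [c k]. *)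
have := Qp (l ^+ (n.-1 - k)); rewrite -{1}[p](subrK (\sum_k c k *: l ^+ k)).
rewrite residueDl (residue_jacl _ cP) add0r residue_suml (bigD1 k) //=.
have kn := ltn_ord k.
rewrite residueZl residue_powers ifT; last by apply/eqP; lia.
rewrite big1 ?addr0 => [/eqP|j jk].
  by rewrite mulf_eq0 (negbTE residue_neq0) orbF => /eqP.
rewrite residueZl residue_powers ifN ?mulr0 //.
by apply: contra jk => /eqP E; apply/eqP/val_inj => /=; lia.
Qed.

(** Non-degeneracy gives injectivity: a class in tau^-1 G_0 is orthogonal to everything, hence in
    the ideal. Surjectivity is [Glat_gclass]. *)
Lemma euler_form_T1_iso : T1_iso h f euler_form.
Proof.
split=> [|p|a Ga].
- have := log_euler_form 1 hH; suff -> : fmul 1 (euler_form : form) = euler_form by [].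
  by apply/ffunP => K; rewrite ffunE mul1r.
- have hH' : h \is (n.-1.+1).-homog by rewrite prednK.
  rewrite (T1_zero_jac p hH' fH); split=> [|Gp]; first exact: (Glat_jac n0 hH fH).
  by apply: residue_nondeg => q; exact: residue_Glat.
by have [p] := Glat_gclass n0 hH fH Ga; exists p.
Qed.

End Pairing.
End Residue.

(** * Frobenius structures with constant coefficients *)

Section ConstantFrobenius.
Context {R : realType} {n : nat}.
Local Notation C := (complex R).
Local Notation cpoly := {mpoly C[n]}.
Local Notation ps := (@ps_of_mpoly R n).
Implicit Types (p q h f l : cpoly).

Lemma psmul0 (a : pseries R n) : psmul a 0 = 0.
Proof. by apply/funext => m; rewrite /psmul big1 // => k _; rewrite mulr0. Qed.

Lemma ps0mul (a : pseries R n) : psmul 0 a = 0.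
Proof. by apply/funext => m; rewrite /psmul big1 // => k _; rewrite mul0r. Qed.

Lemma psderiv0 (i : 'I_n) : psderiv i 0 = 0 :> pseries R n.
Proof. by apply/funext => m; rewrite /psderiv mul0rn. Qed.

Lemma psderiv_const (i : 'I_n) (c : C) : psderiv i (psconst c) = 0 :> pseries R n.
Proof. by rewrite ps_const ps_deriv mderivC ps0. Qed.

Lemma psmul_const (c c' : C) : psmul (psconst c) (psconst c') = psconst (c * c') :> pseries R n.
Proof. by rewrite !ps_const psM mpolyCM. Qed.

Lemma psconst_sum I (r : seq I) (P : pred I) (F : I -> C) :
  psconst (\sum_(i <- r | P i) F i) = \sum_(i <- r | P i) psconst (F i) :> pseries R n.
Proof.
rewrite ps_const (raddf_sum (@mpolyC n C)) -big_filter ps_sum big_filter.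
by apply: eq_bigr => i _; rewrite ps_const.
Qed.

Lemma psconst_convergent (c : C) : convergent (psconst c : pseries R n).
Proof. by rewrite ps_const; exact: ps_convergent. Qed.

Lemma ps_at0_const (c : C) : ps_at0 (psconst c : pseries R n) = c.
Proof. by rewrite /ps_at0 /psconst eqxx. Qed.

Lemma psderiv_X (i j : 'I_n) : psderiv j (ps 'X_i) = psconst (i == j)%:R.
Proof. by rewrite ps_deriv mderiv_X ps_const; case: eqP; rewrite ?mpolyC1 ?mpolyC0. Qed.

Lemma sum_delta (F : 'I_n -> C) (i : 'I_n) : \sum_j F j * (j == i)%:R = F i.
Proof.
rewrite (bigD1 i) //= eqxx mulr1 big1 ?addr0 // => j /negbTE ->.
by rewrite mulr0.
Qed.

Lemma psZ_const (c c' : C) : c *: (psconst c' : pseries R n) = psconst (c * c').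
Proof. by rewrite !ps_const -psZ -mul_mpolyC -mpolyCM. Qed.

Section Cubic.
Context (T : 'I_n -> 'I_n -> 'I_n -> C).
Context (T12 : forall i j k, T i j k = T j i k) (T23 : forall i j k, T i j k = T i k j).

Let lin i j : cpoly := \sum_k T i j k *: 'X_k.
Let quad i : cpoly := \sum_j 'X_j * lin i j.

(** The form T(x, x, x)/6, nested so that each derivative is taken one variable at a time. *)
Definition cubic : cpoly := 6%:R^-1 *: \sum_i 'X_i * quad i.

Let sum_deltaX (F : 'I_n -> cpoly) i : \sum_j (j == i)%:R * F j = F i.
Proof.
rewrite (bigD1 i) //= eqxx mul1r big1 ?addr0 // => j /negbTE ->.
by rewrite mul0r.
Qed.

Let lin_deriv i j k : (lin i j)^`M(k) = (T i j k)%:MP.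
Proof.
rewrite /lin (raddf_sum (mderiv k)) /=.
under eq_bigr => m _ do rewrite mderivZ mderiv_X -mul_mpolyC mulrC.
exact: (sum_deltaX (fun m => (T i j m)%:MP)).
Qed.

Let quad_deriv i k : (quad i)^`M(k) = 2%:R *: lin i k.
Proof.
rewrite /quad (raddf_sum (mderiv k)) /=.
under eq_bigr => j _ do rewrite mderivM mderiv_X lin_deriv.
rewrite big_split /= sum_deltaX scaler_nat mulr2n; congr (_ + _).
by apply: eq_bigr => j _; rewrite T23 mulrC mul_mpolyC.
Qed.

Lemma cubic_deriv i j k : (cubic^`M(i))^`M(j)^`M(k) = (T i j k)%:MP.
Proof.
have -> : cubic^`M(i) = 2%:R^-1 *: quad i.
  rewrite /cubic mderivZ (raddf_sum (mderiv i)) /=.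
  under eq_bigr => m _ do rewrite mderivM mderiv_X quad_deriv.
  rewrite big_split /= sum_deltaX.
  have -> : \sum_m 'X_m * (2%:R *: lin m i) = 2%:R *: quad i.
    rewrite scaler_sumr; apply: eq_bigr => m _; rewrite -scalerAr.
    by congr (_ *: (_ * _)); apply: eq_bigr => k' _; rewrite T12.
  rewrite -[X in _ *: (X + _)]scale1r -scalerDl scalerA; congr (_ *: _).
  by field.
by rewrite mderivZ quad_deriv scalerA mulVf ?scale1r ?lin_deriv // pnatr_eq0.
Qed.

Lemma msize_cubic : (msize cubic <= 4)%N.
Proof.
have cH : cubic \is 3.-homog.
  apply/rpredZ/rpred_sum => i _; apply: (@dhomogM _ _ mdeg 1 _ 2); first exact: X_homog.
  apply: rpred_sum => j _; apply: (@dhomogM _ _ mdeg 1 _ 1); first exact: X_homog.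
  by apply: rpred_sum => k _; apply: rpredZ; exact: X_homog.
by rewrite msizeE; apply/bigmax_leqP_seq => m /(dhomog_mf cH) /= ->.
Qed.

End Cubic.

Definition constant_frobenius (eta : 'M[C]_n) (c : 'I_n -> 'I_n -> 'I_n -> C)
    (e : 'I_n -> C) : @frobenius_data R n :=
  FrobeniusData (fun i j => psconst (eta i j)) (fun i j k => psconst (c i j k))
    (fun i => psconst (e i)) (fun i => ps 'X_i) (fun _ _ _ => 0).

(* The Euler field sum_i u_i d_i rescales the metric by 2. *)
Lemma constant_frobeniusP (eta : 'M[C]_n) c e :
  (forall i j, eta i j = eta j i) -> \det eta != 0 ->
  (forall i j k, c i j k = c j i k) ->
  (forall i j k m, \sum_l c i j l * c l k m = \sum_l c j k l * c i l m) ->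
  (forall j k, \sum_i e i * c i j k = (j == k)%:R) ->
  (forall i j k, \sum_m c i j m * eta m k = \sum_m c j k m * eta i m) ->
  is_frobenius (constant_frobenius eta c e) /\
  frobenius_constant (constant_frobenius eta c e).
Proof.
move=> etaC etaD cC cA cU cI; split.
  split; rewrite /constant_frobenius /=.
  - split=> *; try exact: psconst_convergent.
    + exact: ps_convergent.
    + by rewrite -ps0; exact: ps_convergent.
  - by move=> i j; rewrite etaC.
  - rewrite (_ : \matrix_(i, j) _ = eta) //; apply/matrixP => i j.
    by rewrite mxE ps_at0_const.
  - by move=> i j k; rewrite cC.
  - move=> i j k m; under eq_bigr do rewrite psmul_const.
    under [RHS]eq_bigr do rewrite psmul_const.
    by rewrite -!psconst_sum cA.
  - move=> j k; under eq_bigr do rewrite psmul_const.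
    by rewrite -psconst_sum cU; case: eqP.
  - move=> i j k; under eq_bigr do rewrite psmul_const.
    under [RHS]eq_bigr do rewrite psmul_const.
    by rewrite -!psconst_sum cI.
  - by [].
  - move=> k i j; rewrite psderiv_const big1 // => m _.
    by rewrite !ps0mul addr0.
  - move=> i j k m; rewrite !psderiv0 !big1 // => l _; exact: psmul0.
  - move=> i k; rewrite psderiv_const big1 ?addr0 // => j _; exact: psmul0.
  - move=> i j k m; rewrite !psderiv_const !big1 // => l _;
    by rewrite !psmul0 !ps0mul !subr0.
  - move=> i j k; under eq_bigr => m _ do
      rewrite psderiv_const psmul0 sub0r !psderiv_X !psmul_const.
    rewrite 2!big_split /= sumrN -!psconst_sum.
    have -> : \sum_m c i j m * (k == m)%:R = c i j k.
      by under eq_bigr do rewrite eq_sym; rewrite sum_delta.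
    have -> : \sum_m (m == i)%:R * c m j k = c i j k.
      by under eq_bigr do rewrite mulrC; rewrite (sum_delta (fun m => c m j k)).
    have -> : \sum_m (m == j)%:R * c i m k = c i j k.
      by under eq_bigr do rewrite mulrC; rewrite (sum_delta (fun m => c i m k)).
    by rewrite addNr add0r.
  - exists 2%:R => i j; under eq_bigr => m _ do
      rewrite psderiv_const psmul0 add0r !psderiv_X !psmul_const.
    rewrite big_split /= -!psconst_sum.
    have -> : \sum_m (m == i)%:R * eta m j = eta i j.
      by under eq_bigr do rewrite mulrC; rewrite (sum_delta (fun m => eta m j)).
    have -> : \sum_m (m == j)%:R * eta i m = eta i j.
      by under eq_bigr do rewrite mulrC; rewrite (sum_delta (fun m => eta i m)).
    by rewrite scaler_nat mulr2n.
(* Commutativity and invariance make g(d_i o d_j, d_k) totally symmetric, so it has a cubic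
   potential. *)
pose T i j k := \sum_m c i j m * eta m k.
have T12 i j k : T i j k = T j i k by apply: eq_bigr => m _; rewrite cC.
have T23 i j k : T i j k = T i k j.
  rewrite T12 /T cI; apply: eq_bigr => m _; by rewrite etaC.
have delta2 (F : 'I_n -> 'I_n -> C) i j : psconst (F i j) =
    \sum_a \sum_b F a b *: psmul (psderiv i (ps 'X_a)) (psderiv j (ps 'X_b)).
  under eq_bigr => a _ do under eq_bigr => b _ do
    rewrite !psderiv_X psmul_const psZ_const mulrCA mulrC.
  under eq_bigr => a _ do rewrite -psconst_sum -mulr_suml sum_delta.
  by rewrite -psconst_sum (sum_delta (fun a => F a j)).
exists (fun a => ps 'X_a), eta, c, (cubic T); split.
- move=> a; split; first exact: ps_convergent.
  rewrite /ps_at0 /ps_of_mpoly mcoeffX; case: eqP => // /(congr1 mdeg).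
  by rewrite mdeg1 mdeg0.
- rewrite (_ : \matrix_(i, a) _ = 1%:M) ?det1 ?oner_neq0 //.
  by apply/matrixP => i a; rewrite !mxE psderiv_X ps_at0_const eq_sym.
- by move=> i j; exact: (delta2 (fun a b => eta a b)).
- move=> i j k; rewrite -(delta2 (fun a b => c a b k)) /=.
  under eq_bigr => m _ do rewrite psderiv_X psmul_const eq_sym.
  by rewrite -psconst_sum sum_delta.
- split; first exact: msize_cubic.
  by move=> a b k; rewrite (cubic_deriv T12 T23).
Qed.

End ConstantFrobenius.

(** * Assembly of the Frobenius structure from T^1 and the residue form *)

Theorem theorem5p7 (R : realType) (n : nat) (h f : {mpoly (complex R)[n]})
    (hD : linear_free_divisor h)
    (hf : f \is 1.-homog)
    (hfin : Rh_finite h f)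
    (V : complex R -> rat -> set (int -> extform R n))
    (hV : forall t, t != 0 -> KM_filtration h f t (V t))
    (P : complex R -> @pairing_t R n)
    (hP : forall t, t != 0 -> sabbah_pairing h f t (V t) (P t))
    (S : @pairing_loc R n)
    (hH : hypothesis_H h f P S)
    (hmin : forall t, t != 0 -> min_spectral_simple h f t (V t))
    (g : 'I_n -> {mpoly (complex R)[n]})
    (hg : T1_basis h f g) :
  exists F : @frobenius_data R n,
    [/\ is_frobenius F, frobenius_on_base h f g S F & frobenius_constant F].
Proof.
have [l [n0 hHom lH lf span]] := jacobian_structure hD hf hg.
have hHom' : h \is (n.-1.+1).-homog by rewrite prednK.
have T1J p := T1_zero_jac p hHom' hf.
have [gspan gfree] := hg.
have coord p : exists a : 'I_n -> complex R, jac h f 0 (p - \sum_i a i *: g i).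
  have [a aP] := gspan _ (ps_convergent p); exists a; apply/T1J.
  by rewrite psB ps_sum; under eq_bigr do rewrite psZ.
have free (a : 'I_n -> complex R) : jac h f 0 (\sum_i a i *: g i) -> forall i, a i = 0.
  move=> /T1J; rewrite ps_sum; under eq_bigr do rewrite psZ; exact: gfree.
(* Uniqueness of coordinates turns ring identities modulo the ideal into identities between
   structure constants. *)
have uniq (a b : 'I_n -> complex R) p : jac h f 0 (p - \sum_i a i *: g i) ->
    jac h f 0 (p - \sum_i b i *: g i) -> forall i, a i = b i.
  move=> Ja Jb i; apply/eqP; rewrite -subr_eq0; apply/eqP.
  apply: (free (fun i => a i - b i)); under eq_bigr do rewrite scalerBl.
  rewrite sumrB; have := jacB Jb Ja; by rewrite opprB addrC addrA subrK.
have lincomb (a : 'I_n -> complex R) (p : 'I_n -> {mpoly (complex R)[n]})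
    (b : 'I_n -> 'I_n -> complex R) :
    (forall m, jac h f 0 (p m - \sum_k b m k *: g k)) ->
    jac h f 0 (\sum_m a m *: p m - \sum_k (\sum_m a m * b m k) *: g k).
  move=> J; have -> : \sum_k (\sum_m a m * b m k) *: g k =
      \sum_m a m *: \sum_k b m k *: g k.
    under [RHS]eq_bigr do rewrite scaler_sumr; rewrite exchange_big /=.
    apply: eq_bigr => k _; rewrite scaler_suml.
    by apply: eq_bigr => m _; rewrite scalerA.
  rewrite -sumrB; apply: jac_sum => m _; rewrite -scalerBr; exact: jacZ.
have [e eP] := coord 1.
have [c cP] : exists c : 'I_n -> 'I_n -> 'I_n -> complex R,
    forall i j, jac h f 0 (g i * g j - \sum_k c i j k *: g k).
  have [c cP] := choice (fun ij : 'I_n * 'I_n => coord (g ij.1 * g ij.2)).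
  by exists (fun i j => c (i, j)) => i j; exact: (cP (i, j)).
have P1 := hP 1 (oner_neq0 _); have V1 := hV 1 (oner_neq0 _).
have min1 := hmin 1 (oner_neq0 _).
pose Q := residue S.
have Qsym : forall p q, Q p q = Q q p := residue_sym n0 hHom hf hH P1.
have Qmul : forall p q, Q p q = Q 1 (p * q) := residue_mul n0 hHom hf hH P1 lH lf span.
have Qjac p q : jac h f 0 p -> Q p q = 0 := residue_jacl n0 hHom hf hH q (p := p).
have Qsum (a : 'I_n -> complex R) q : Q (\sum_i a i *: g i) q = \sum_i a i * Q (g i) q.
  rewrite /Q (residue_suml hHom hH); apply: eq_bigr => i _.
  by rewrite (residueZl hHom hH).
have Qcoord (a : 'I_n -> complex R) p q : jac h f 0 (p - \sum_i a i *: g i) ->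
    Q p q = \sum_i a i * Q (g i) q.
  move=> J; rewrite -Qsum -[p in LHS](subrK (\sum_i a i *: g i)).
  by rewrite /Q (residueDl hHom hH) [X in X + _](Qjac _ _ J) add0r.
pose eta : 'M_n := \matrix_(i, j) Q (g i) (g j).
have [||||||isF constF] := @constant_frobeniusP R n eta c e.
- by move=> i j; rewrite !mxE.
(* A kernel vector of [eta] gives a combination of the g_i orthogonal to everything, hence in the
   ideal. *)
- apply/negP => /det0P[v v0 vE]; move/eqP: v0; apply; apply/rowP => i; rewrite mxE.
  move: i; apply: free.
  apply: (residue_nondeg n0 hHom hf hH P1 lH lf span V1 min1) => q.
  have [b bP] := coord q; rewrite -/(Q _ _) Qsym (Qcoord _ _ _ bP) big1 // => j _.
  rewrite Qsym Qsum; have /rowP/(_ j) := vE; rewrite !mxE.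
  under eq_bigr do rewrite mxE; by move=> ->; rewrite mulr0.
- by move=> i j; apply: uniq (cP i j) _; rewrite mulrC; exact: cP.
(* Both sides of associativity are the coordinates of this triple product. *)
- move=> i j k; apply: (uniq _ _ (g i * g j * g k)).
    have := lincomb (c i j) (fun m => g m * g k) (fun m => c m k) (fun m => cP m k).
    have := jacM (g k) (cP i j); rewrite mulrBr [g k * _]mulrC mulr_sumr.
    under eq_bigr do rewrite -scalerAr mulrC.
    by move=> J1 J2; have := jacD J1 J2; rewrite addrA subrK.
  have := lincomb (c j k) (fun m => g i * g m) (fun m => c i m) (fun m => cP i m).
  have := jacM (g i) (cP j k); rewrite mulrBr mulrA mulr_sumr.
  under eq_bigr do rewrite -scalerAr.
  by move=> J1 J2; have := jacD J1 J2; rewrite addrA subrK.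
- move=> j; apply: (uniq _ _ (g j)).
    have := lincomb e (fun m => g m * g j) (fun m => c m j) (fun m => cP m j).
    have := jacM (g j) eP; rewrite mulrBr mulr1 mulr_sumr.
    under eq_bigr do rewrite -scalerAr mulrC.
    by move=> J1 J2; have := jacD J1 J2; rewrite addrA subrK.
  rewrite (bigD1 j) //= eqxx scale1r big1 ?addr0 ?subrr => [|k]; first exact: jac0.
  by rewrite eq_sym => /negbTE ->; rewrite scale0r.
(* Both sides of invariance equal Q(1, g_i g_j g_k). *)
- move=> i j k; under eq_bigr do rewrite mxE.
  rewrite -(Qcoord _ _ _ (cP i j)); under [RHS]eq_bigr do rewrite mxE Qsym.
  by rewrite -(Qcoord _ _ _ (cP j k)) Qmul [RHS]Qmul; congr (Q 1 _); ring.
exists (constant_frobenius eta c e); split=> //; split=> [i j|].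
  have /T1J := cP i j; rewrite psB ps_sum; under eq_bigr do rewrite psZ.
  by move=> J; under eq_bigr do rewrite ps_at0_const.
exists euler_form; last by move=> i j; rewrite ps_at0_const mxE.
exact: (euler_form_T1_iso n0 hHom hf hH P1 lH lf span V1 min1).
Qed.
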